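(* Let $\theta\ge 2$ be an integer, let $(a_{ij})_{1\le i,j\le\theta}$ be a Cartan matrix of finite type, and let $G$ be a finite abelian group with group of (complex) characters $\widehat{G}$. For $1\le i\le\theta$ let $g_i\in G$ and $\chi_i\in\widehat{G}$ be such that $\chi_i(g_i)\ne 1$ and $\chi_j(g_i)\chi_i(g_j)=\chi_i(g_i)^{a_{ij}}$ for all $1\le i,j\le\theta$. Let $N_i$ be the order of $\chi_i(g_i)$, and assume that $N_i$ is odd for all $i$ and prime to $3$ for all $i$ in a connected component of type $\mathrm{G}_2$. Let $V$ be the complex vector space with basis $x_1,\dots,x_\theta$, regarded as a Yetter-Drinfeld module over $\mathbb{C}G$ by letting $V_g$ be the span of all $x_i$ with $g_i=g$ and $g(x_i)=\chi_i(g)x_i$ for $g\in G$. Let $R=\mathcal{B}(V)$ be the Nichols algebra of $V$ and let $u(\mathcal{D})=R\#\mathbb{C}G$ be its Radford bosonization, where $\mathcal{D}=(G,(g_i),(\chi_i),(a_{ij}))$. Assume that $\chi_i^{N_i}$ is the trivial character for all $i$ and that the only common solution $(c_1,\dots,c_\theta)\in\{0,1\}^\theta$ of the equations $$\chi_1(g)^{c_1}\cdots\chi_\theta(g)^{c_\theta}=1\qquad\text{for all } g\in G$$ is $(c_1,\dots,c_\theta)=(0,\dots,0)$. Then $R$ and $u(\mathcal{D})$ are both wild.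
   Context: The Cartan matrix is of finite type if its Dynkin diagram is a disjoint union of copies of diagrams $\mathrm{A}_n,\mathrm{B}_n,\mathrm{C}_n,\mathrm{D}_n,\mathrm{E}_6,\mathrm{E}_7,\mathrm{E}_8,\mathrm{F}_4,\mathrm{G}_2$; connected components refer to this diagram. A Yetter-Drinfeld module over $kG$ is a $G$-graded vector space $V=\bigoplus_gV_g$ that is a $kG$-module with $g\cdot V_h=V_{ghg^{-1}}$; the coaction is $\delta(v)=g\otimes v$ for $v\in V_g$. The category ${}^G_G\mathcal{YD}$ is braided with $c(u\otimes v)=g(v)\otimes u$ for $u\in U_g$. The tensor algebra $T(V)$ is a braided Hopf algebra in ${}^G_G\mathcal{YD}$ in which the elements of $V$ are primitive, and the Nichols algebra $\mathcal{B}(V)$ is the quotient of $T(V)$ by the largest homogeneous ideal generated by elements of degree $\ge 2$ that is also a coideal. Under the hypotheses above $\mathcal{B}(V)$ is finite dimensional. The Radford bosonization $R\#kG$ of a braided Hopf algebra $R$ is the free $R$-module with basis $G$, with product $(rg)(sh)=r(g\cdot s)gh$ and coproduct $\Delta(rg)=\sum r^{(1)}(r^{(2)})_{(-1)}g\otimes(r^{(2)})_{(0)}g$, where $\sum r^{(1)}\otimes r^{(2)}$ is the coproduct of $r$ in $R$ and $\sum r_{(-1)}\otimes r_{(0)}$ its coaction. A finite dimensional $\mathbb{C}$-algebra $B$ is wild if there is a finitely generated $B$-$\mathbb{C}\langle X,Y\rangle$-bimodule $F$, free as a right $\mathbb{C}\langle X,Y\rangle$-module, such that the functor $F\otimes_{\mathbb{C}\langle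 X,Y\rangle}-$ from finite dimensional $\mathbb{C}\langle X,Y\rangle$-modules to finite dimensional $B$-modules preserves indecomposability and reflects isomorphism. *)

(* Defs.v *)
From HB Require Import structures.
From mathcomp Require Import all_boot all_order all_algebra fingroup.
From mathcomp Require Import generic_quotient ring_quotient.
From mathcomp Require Import boolp reals complex.
From mathcomp Require Import finmap monalg ring.

Set Implicit Arguments.
Unset Strict Implicit.
Unset Printing Implicit Defensive.

Import GRing.Theory.
Local Open Scope ring_scope.
Local Open Scope quotient_scope.

Inductive dynkin_type :=
  | DynA of nat | DynB of nat | DynC of nat | DynD of nat | DynE of nat
  | DynF4 | DynG2.

Definition dynkin_wf (T : dynkin_type) : bool :=
  match T with
  | DynA n => (1 <= n)%N
  | DynB n => (2 <= n)%N
  | DynC n => (3 <= n)%N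
  | DynD n => (4 <= n)%N
  | DynE n => (6 <= n <= 8)%N
  | DynF4 | DynG2 => true
  end.

Definition dynkin_rank (T : dynkin_type) : nat :=
  match T with
  | DynA n | DynB n | DynC n | DynD n | DynE n => n
  | DynF4 => 4
  | DynG2 => 2
  end.

(* Vertices are numbered from 0.  [branch n k] is the tree consisting of the
   chain 0 - 1 - ... - (n - 2) and of the vertex n - 1 joined to k, which is
   D_n for k = n - 3 and E_n for k = 2. *)
Definition chain (p q : nat) : bool := (p.+1 == q) || (q.+1 == p).
Definition branch (n k p q : nat) : bool :=
  [|| [&& (p < n.-1)%N, (q < n.-1)%N & chain p q],
      (p == n.-1) && (q == k)
    | (q == n.-1) && (p == k)].

Definition dynkin_adj (T : dynkin_type) : rel nat :=
  match T with
  | DynD n => branch n (n - 3)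
  | DynE n => branch n 2
  | _ => chain
  end.

(* The entry is a_pq = 2 (alpha_p, alpha_q) / (alpha_p, alpha_p), so that the
   larger absolute value is in the row of the shorter root. *)
Definition dynkin_weight (T : dynkin_type) (p q : nat) : nat :=
  match T with
  | DynB n => if (p == n.-1) && (q == n.-2) then 2 else 1
  | DynC n => if (p == n.-2) && (q == n.-1) then 2 else 1
  | DynF4 => if (p == 2) && (q == 1) then 2 else 1
  | DynG2 => if (p == 0) && (q == 1) then 3 else 1
  | _ => 1
  end.

Definition dynkin_cartan (T : dynkin_type) : 'M[int]_(dynkin_rank T) :=
  \matrix_(p, q)
    if p == q then 2
    else if dynkin_adj T p q then - (dynkin_weight T p q)%:Z else 0.

Definition generalized_cartan n (a : 'M[int]_n) : Prop :=
  [/\ forall i, a i i = 2,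
      forall i j, i != j -> a i j <= 0
    & forall i j, a i j = 0 -> a j i = 0].

Definition dynkin_edge n (a : 'M[int]_n) : rel 'I_n :=
  [rel i j | (i != j) && (a i j != 0)].

Definition component_of_type n (a : 'M[int]_n) (i : 'I_n) (T : dynkin_type) :=
  exists f : 'I_(dynkin_rank T) -> 'I_n,
    [/\ injective f,
        forall j, connect (dynkin_edge a) i j <-> exists p, f p = j
      & forall p q, a (f p) (f q) = dynkin_cartan T p q].

Definition cartan_finite_type n (a : 'M[int]_n) : Prop :=
  generalized_cartan a /\
  forall i, exists2 T, dynkin_wf T & component_of_type a i T.

Lemma malg_scaleU (K : nzRingType) (I : choiceType) (a b : K) (k : I) :
  a *: << b *g k >> = << a * b *g k >> :> {malg K[I]}.
Proof. by apply/malgP => u; rewrite mcoeffZ !mcoeffU mulrnAr. Qed.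

(* The linear extension of h; locked so that conversion does not unfold it. *)
HB.lock Definition mlift (K : comNzRingType) (I : choiceType) (V : lmodType K)
    (h : I -> V) (f : {malg K[I]}) : V := \sum_(k <- msupp f) f@_k *: h k.

Section LinearExtension.
Variables (K : comNzRingType) (I : choiceType) (V : lmodType K) (h : I -> V).
Local Notation mlift := (@mlift K I V h).

Lemma mliftEw (d : {fset I}) f : fsubset (msupp f) d ->
  mlift f = \sum_(k <- d) f@_k *: h k.
Proof.
move=> le; rewrite mlift.unlock [LHS](big_fset_incl _ le) => //= x xd.
by move=> /mcoeff_outdom ->; rewrite scale0r.
Qed.

Lemma mlift_is_linear : linear mlift.
Proof.
move=> c f g.
set d := fsetU (msupp f) (msupp g).
have hf : fsubset (msupp f) d by apply: fsubsetUl.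
have hg : fsubset (msupp g) d by apply: fsubsetUr.
have hfg : fsubset (msupp (c *: f + g)) d.
  apply: (fsubset_trans (msuppD_le _ _)); apply: fsetSU.
  exact: msuppZ_le.
rewrite (mliftEw hf) (mliftEw hg) (mliftEw hfg) scaler_sumr -big_split /=.
by apply: eq_bigr => k _; rewrite mcoeffD mcoeffZ scalerDl scalerA.
Qed.

HB.instance Definition _ :=
  GRing.isLinear.Build K {malg K[I]} V *:%R mlift mlift_is_linear.

Lemma mliftU c k : mlift << c *g k >> = c *: h k.
Proof. by rewrite (mliftEw msuppU_le) big_seq_fset1 mcoeffUU. Qed.

End LinearExtension.

Lemma eq_mlift (K : comNzRingType) (I : choiceType) (V : lmodType K)
    (h h' : I -> V) f : h =1 h' -> mlift h f = mlift h' f.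
Proof.
by move=> hh; rewrite mlift.unlock; apply: eq_bigr => k _; rewrite hh.
Qed.

Lemma mlift_funD (K : comNzRingType) (I : choiceType) (V : lmodType K)
    (h h' : I -> V) f :
  mlift (fun k => h k + h' k) f = mlift h f + mlift h' f.
Proof.
by rewrite mlift.unlock -big_split; apply: eq_bigr => k _; rewrite scalerDr.
Qed.

Lemma malg_ind (K : nzRingType) (I : choiceType) (P : {malg K[I]} -> Prop) :
  P 0 -> (forall f h, P f -> P h -> P (f + h)) ->
  (forall c k, P << c *g k >>) -> forall f, P f.
Proof. by move=> P0 PD PU f; rewrite [f]monalgE; apply: big_ind. Qed.

Lemma malg_scaleAr (K : comNzRingType) (M : monomType) (c : K)
    (f g : {malg K[M]}) : c *: (f * g) = f * (c *: g).
Proof.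
apply/malgP => w; rewrite mcoeffZ.
rewrite (mcoeffMlw _ (fsubset_refl (msupp f)) (fsubset_refl (msupp g))).
rewrite (mcoeffMlw _ (fsubset_refl (msupp f)) (msuppZ_le c g)) mulr_sumr.
apply: eq_bigr => u _; rewrite mulr_sumr; apply: eq_bigr => v _.
by rewrite mcoeffZ mulrnAr mulrCA.
Qed.

(* The free algebra K<x_0, ..., x_(n-1)>, with basis the words in the x_i. *)
Definition free_alg (K : comNzRingType) (n : nat) : Type :=
  {malg K[{fmonom 'I_n}]}.

Section FreeAlgebra.
Variables (K : comNzRingType) (n : nat).

HB.instance Definition _ := GRing.Lalgebra.on (free_alg K n).

Lemma free_alg_scaleAr (c : K) (f g : free_alg K n) :
  c *: (f * g) = f * (c *: g).
Proof. exact: malg_scaleAr. Qed.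

HB.instance Definition _ :=
  GRing.Lalgebra_isAlgebra.Build K (free_alg K n) free_alg_scaleAr.

End FreeAlgebra.

Definition two_sided_ideal (A : nzRingType) (I : A -> Prop) : Prop :=
  [/\ I 0, forall f h, I f -> I h -> I (f + h),
      forall a f, I f -> I (a * f) & forall a f, I f -> I (f * a)].

Record proper_ideal (A : nzRingType) := ProperIdeal {
  ideal_mem :> A -> Prop;
  ideal_two_sided : two_sided_ideal ideal_mem;
  ideal_proper : ~ ideal_mem 1
}.

Section QuotientAlgebra.
Variables (K : fieldType) (A : algType K) (I : proper_ideal A).

Definition ideal_pred : {pred A} := fun f => `[< I f >].

Lemma ideal_predP f : reflect (I f) (f \in ideal_pred).
Proof. exact: asboolP. Qed.

Lemma ideal_zmod_closed : zmod_closed ideal_pred.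
Proof.
have [I0 ID IMl _] := ideal_two_sided I.
split; first exact/ideal_predP.
move=> f h /ideal_predP If /ideal_predP Ih; apply/ideal_predP.
by apply: ID => //; rewrite -mulN1r; apply: IMl.
Qed.

HB.instance Definition _ := GRing.isZmodClosed.Build A ideal_pred
  ideal_zmod_closed.

Definition quot_alg : Type := Quotient.quot ideal_pred.
HB.instance Definition _ := GRing.Zmodule.on quot_alg.

Definition quot_pi (f : A) : quot_alg := \pi_(Quotient.quot ideal_pred) f.
Definition quot_repr (f : quot_alg) : A := repr (f : Quotient.quot ideal_pred).

Lemma quot_reprK f : quot_pi (quot_repr f) = f.
Proof. exact: reprK. Qed.

Lemma quot_piP f h : quot_pi f = quot_pi h <-> I (f - h).
Proof.
split=> [/eqP|Ifh]; first by rewrite -Quotient.idealrBE => /ideal_predP.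
by apply/eqP; rewrite -Quotient.idealrBE; apply/ideal_predP.
Qed.

Lemma quot_reprP f : I (quot_repr (quot_pi f) - f).
Proof. by apply/quot_piP; rewrite quot_reprK. Qed.

Lemma quot_pi_is_zmod_morphism : zmod_morphism quot_pi.
Proof. by move=> f h; rewrite /quot_pi raddfB. Qed.
HB.instance Definition _ := GRing.isZmodMorphism.Build A quot_alg quot_pi
  quot_pi_is_zmod_morphism.

Definition quot_one : quot_alg := quot_pi 1.
Definition quot_mul (f h : quot_alg) : quot_alg :=
  quot_pi (quot_repr f * quot_repr h).
Definition quot_scale (c : K) (f : quot_alg) : quot_alg :=
  quot_pi (c *: quot_repr f).

Lemma quot_piM f h : quot_pi (f * h) = quot_mul (quot_pi f) (quot_pi h).
Proof.
have [I0 ID IMl IMr] := ideal_two_sided I.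
apply/esym/quot_piP.
rewrite -[X in X - _](addrNK (f * quot_repr (quot_pi h))) -mulrBl -addrA.
rewrite -mulrBr.
by apply: ID; [apply: IMr | apply: IMl]; apply: quot_reprP.
Qed.

Lemma quot_piZ c f : quot_pi (c *: f) = quot_scale c (quot_pi f).
Proof.
have [I0 ID IMl IMr] := ideal_two_sided I.
apply/esym/quot_piP; rewrite -scalerBr -[_ - _]mul1r scalerAl.
exact/IMl/quot_reprP.
Qed.

Lemma quot_mulA : associative quot_mul.
Proof.
move=> x y z; rewrite -[x]quot_reprK -[y]quot_reprK -[z]quot_reprK.
by rewrite -!quot_piM mulrA.
Qed.
Lemma quot_mul1 : left_id quot_one quot_mul.
Proof. by move=> x; rewrite -[x]quot_reprK -quot_piM mul1r. Qed.
Lemma quot_mulr1 : right_id quot_one quot_mul.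
Proof. by move=> x; rewrite -[x]quot_reprK -quot_piM mulr1. Qed.
Lemma quot_mulDl : left_distributive quot_mul +%R.
Proof.
move=> x y z; rewrite -[x]quot_reprK -[y]quot_reprK -[z]quot_reprK.
by rewrite -raddfD -!quot_piM mulrDl raddfD.
Qed.
Lemma quot_mulDr : right_distributive quot_mul +%R.
Proof.
move=> x y z; rewrite -[x]quot_reprK -[y]quot_reprK -[z]quot_reprK.
by rewrite -raddfD -!quot_piM mulrDr raddfD.
Qed.
Lemma quot_one_neq0 : quot_one != 0.
Proof.
apply/eqP; rewrite -[0](raddf0 quot_pi) => /quot_piP; rewrite subr0.
exact: ideal_proper.
Qed.

HB.instance Definition _ := GRing.Zmodule_isNzRing.Build quot_alg
  quot_mulA quot_mul1 quot_mulr1 quot_mulDl quot_mulDr quot_one_neq0.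

Lemma quot_scaleA a b x : quot_scale a (quot_scale b x) = quot_scale (a * b) x.
Proof. by rewrite -[x]quot_reprK -!quot_piZ scalerA. Qed.
Lemma quot_scale1 : left_id 1 quot_scale.
Proof. by move=> x; rewrite -[x]quot_reprK -quot_piZ scale1r. Qed.
Lemma quot_scaleDr : right_distributive quot_scale +%R.
Proof.
move=> a x y; rewrite -[x]quot_reprK -[y]quot_reprK.
by rewrite -raddfD -!quot_piZ scalerDr raddfD.
Qed.
Lemma quot_scaleDl x : {morph quot_scale^~ x : a b / a + b}.
Proof. by move=> a b; rewrite -[x]quot_reprK -!quot_piZ scalerDl raddfD. Qed.

HB.instance Definition _ := GRing.Zmodule_isLmodule.Build K quot_alg
  quot_scaleA quot_scale1 quot_scaleDr quot_scaleDl.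

Lemma quot_scaleAl (a : K) (x y : quot_alg) : a *: (x * y) = a *: x * y.
Proof.
rewrite -[x]quot_reprK -[y]quot_reprK.
by rewrite /GRing.scale /GRing.mul /= -!(quot_piM, quot_piZ) scalerAl.
Qed.
HB.instance Definition _ := GRing.Lmodule_isLalgebra.Build K quot_alg
  quot_scaleAl.

Lemma quot_scaleAr (a : K) (x y : quot_alg) : a *: (x * y) = x * (a *: y).
Proof.
rewrite -[x]quot_reprK -[y]quot_reprK.
by rewrite /GRing.scale /GRing.mul /= -!(quot_piM, quot_piZ) scalerAr.
Qed.
HB.instance Definition _ := GRing.Lalgebra_isAlgebra.Build K quot_alg
  quot_scaleAr.

Lemma quot_pi_is_monoid_morphism : monoid_morphism quot_pi.
Proof. by split=> // f h; rewrite quot_piM. Qed.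
HB.instance Definition _ := GRing.isMonoidMorphism.Build A quot_alg quot_pi
  quot_pi_is_monoid_morphism.
Lemma quot_pi_is_scalable : scalable quot_pi.
Proof. by move=> c f; rewrite quot_piZ. Qed.
HB.instance Definition _ := GRing.isScalable.Build K A quot_alg *:%R quot_pi
  quot_pi_is_scalable.

Lemma quot_pi_lin c f h :
  quot_pi (c *: f + h) = c *: quot_pi f + quot_pi h.
Proof. exact: linearP. Qed.

Lemma quot_lin_repr (c : K) (a b : quot_alg) :
  c *: a + b = quot_pi (c *: quot_repr a + quot_repr b).
Proof. by rewrite quot_pi_lin !quot_reprK. Qed.

Lemma quot_mul_repr (a b : quot_alg) :
  a * b = quot_pi (quot_repr a * quot_repr b).
Proof. by []. Qed.

End QuotientAlgebra.

Record algebra_action (K : fieldType) (gT : finGroupType) (A : algType K) :=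
  AlgebraAction {
    alg_act :> gT -> A -> A;
    alg_act_linear : forall x, linear (alg_act x);
    alg_act_mult : forall x, monoid_morphism (alg_act x);
    alg_act1 : forall a, alg_act 1%g a = a;
    alg_actM : forall x y a, alg_act (x * y)%g a = alg_act x (alg_act y a)
  }.

Section SmashProduct.
Variables (K : fieldType) (gT : finGroupType) (A : algType K).
Variable act : algebra_action gT A.

(* The function f stands for the element \sum_x f(x) x of A # KG. *)
Definition smash_alg (act : algebra_action gT A) : Type := {ffun gT -> A}.
Local Notation S := (smash_alg act).

HB.instance Definition _ := GRing.Lmodule.on S.

Definition smash_elt (a : A) (x : gT) : S := [ffun z => a *+ (z == x)].
Definition smash_one : S := smash_elt 1 1%g.
(* This is the bilinear product with (a x) (b y) = a (x . b) x y; see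
   [smash_mul_elt]. *)
Definition smash_mul (f h : S) : S :=
  [ffun z => \sum_x f x * act x (h (x^-1 * z)%g)].

Let actB x : zmod_morphism (act x).
Proof. exact: (zmod_morphism_linear (alg_act_linear act x)). Qed.
Let actZ x c a : act x (c *: a) = c *: act x a.
Proof. exact: (scalable_linear (alg_act_linear act x)). Qed.
Let act0 x : act x 0 = 0.
Proof. by have := actB x 0 0; rewrite !subr0 subrr. Qed.
Let actD x a b : act x (a + b) = act x a + act x b.
Proof. by have:= alg_act_linear act x 1 a b; rewrite !scale1r. Qed.
Let actMul x a b : act x (a * b) = act x a * act x b.
Proof. by have [_ ->] := alg_act_mult act x. Qed.
Let act_one x : act x 1 = 1.
Proof. by have [-> _] := alg_act_mult act x. Qed.
Let act_sum x (J : finType) (F : J -> A) :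
  act x (\sum_j F j) = \sum_j act x (F j).
Proof. exact: (big_morph (act x) (actD x) (act0 x)). Qed.

Lemma smash_mul_elt a x b y :
  smash_mul (smash_elt a x) (smash_elt b y) = smash_elt (a * act x b) (x * y)%g.
Proof.
apply/ffunP => z; rewrite !ffunE (bigD1 x) //= big1 ?addr0.
  rewrite !ffunE eqxx mulr1n -(inj_eq (mulgI x) _ y) mulKVg.
  by case: eqP => _; rewrite ?mulr1n // !mulr0n act0 mulr0.
by move=> t /negPf tx; rewrite !ffunE tx mul0r.
Qed.

Lemma smash_mulA : associative smash_mul.
Proof.
move=> f g h; apply/ffunP => z; rewrite !ffunE.
under [RHS]eq_bigr => y _ do rewrite ffunE mulr_suml.
rewrite exchange_big /=; apply: eq_bigr => x _.
rewrite ffunE act_sum mulr_sumr (reindex_inj (mulgI (x^-1)%g)) /=.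
apply: eq_bigr => y _.
by rewrite actMul -alg_actM mulKVg invMg invgK -!mulgA mulKVg mulrA.
Qed.
Lemma smash_mul1 : left_id smash_one smash_mul.
Proof.
move=> f; apply/ffunP => z; rewrite ffunE (bigD1 1%g) //= big1 ?addr0.
  by rewrite ffunE eqxx mulr1n mul1r alg_act1 invg1 mul1g.
by move=> t /negPf tx; rewrite ffunE tx mul0r.
Qed.
Lemma smash_mulr1 : right_id smash_one smash_mul.
Proof.
move=> f; apply/ffunP => z; rewrite ffunE (bigD1 z) //= big1 ?addr0.
  by rewrite ffunE mulVg eqxx mulr1n act_one mulr1.
move=> t tz; rewrite ffunE -eq_mulVg1 (negPf tz) mulr0n act0 mulr0 //.
Qed.
Lemma smash_mulDl : left_distributive smash_mul +%R.
Proof.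
move=> f g h; apply/ffunP => z; rewrite !ffunE -big_split /=.
by apply: eq_bigr => x _; rewrite ffunE mulrDl.
Qed.
Lemma smash_mulDr : right_distributive smash_mul +%R.
Proof.
move=> f g h; apply/ffunP => z; rewrite !ffunE -big_split /=.
by apply: eq_bigr => x _; rewrite ffunE actD mulrDr.
Qed.
Lemma smash_one_neq0 : smash_one != 0.
Proof.
apply/eqP => /ffunP/(_ 1%g); rewrite !ffunE eqxx mulr1n.
exact/eqP/oner_neq0.
Qed.

HB.instance Definition _ := GRing.Zmodule_isNzRing.Build S
  smash_mulA smash_mul1 smash_mulr1 smash_mulDl smash_mulDr smash_one_neq0.

Lemma smash_scaleAl (c : K) (f g : S) : c *: (f * g) = c *: f * g.
Proof.
apply/ffunP => z; rewrite !ffunE scaler_sumr.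
by apply: eq_bigr => x _; rewrite ffunE scalerAl.
Qed.
HB.instance Definition _ := GRing.Lmodule_isLalgebra.Build K S smash_scaleAl.

Lemma smash_scaleAr (c : K) (f g : S) : c *: (f * g) = f * (c *: g).
Proof.
apply/ffunP => z; rewrite !ffunE scaler_sumr.
by apply: eq_bigr => x _; rewrite ffunE actZ scalerAr.
Qed.
HB.instance Definition _ := GRing.Lalgebra_isAlgebra.Build K S smash_scaleAr.

End SmashProduct.

Record character (K : fieldType) (gT : finGroupType) := Character {
  char_fun :> gT -> K;
  char1 : char_fun 1%g = 1;
  charM : forall x y, char_fun (x * y)%g = char_fun x * char_fun y
}.

Section Nichols.
Variables (K : fieldType) (gT : finGroupType) (n : nat).
Variables (g : 'I_n -> gT) (chi : 'I_n -> character K gT).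

(* V is the Yetter-Drinfeld module with basis x_i (i < n), where x_i has degree
   g i and spans the character chi i, and T(V) is the free algebra. *)
Local Notation word := {fmonom 'I_n}.
Local Notation T := {malg K[word]}.
(* T(V) (x) T(V), with basis the pairs of words *)
Local Notation T2 := {malg K[(word * word)%type]}.

Definition word_deg (w : word) : gT := (\prod_(i <- w) g i)%g.
Definition word_char (w : word) (x : gT) : K := \prod_(i <- w) chi i x.

Definition tens_act (x : gT) (f : T) : T :=
  mlift (fun w => << word_char w x *g w >>) f.

Definition tensT (f h : T) : T2 :=
  mlift (fun u => mlift (fun v => << (u, v) >>) h) f.

(* (u (x) v) (u' (x) v') = u c(v (x) u') v', where the braiding is
   c(v (x) u') = (word_deg v . u') (x) v = word_char u' (word_deg v) u' (x) v. *)
Definition braided_mul (s t : T2) : T2 :=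
  mlift (fun p => mlift (fun q =>
    << word_char q.1 (word_deg p.2) *g (mmul p.1 q.1, mmul p.2 q.2) >>) t) s.

(* The algebra morphism T(V) -> T(V) (x) T(V), for the product braided_mul,
   with x_i |-> x_i (x) 1 + 1 (x) x_i *)
Definition comult (f : T) : T2 :=
  mlift (fun w : word => \big[braided_mul/ << (mone, mone) >>]_(i <- w)
    (<< (fmu i, mone) >> + << (mone, fmu i) >>)) f.

Definition hom_comp (d : nat) (f : T) : T :=
  mlift (fun w => if fdeg w == d then << w >> else 0) f.

Definition homogeneous_ideal (I : T -> Prop) : Prop :=
  two_sided_ideal I /\ forall f, I f -> forall d, I (hom_comp d f).

(* For a homogeneous ideal this says that I is generated by (homogeneous)
   elements of degree at least 2. *)
Definition in_degree_ge2 (I : T -> Prop) : Prop :=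
  forall f, I f -> forall w, (fdeg w < 2)%N -> f@_w = 0.

(* I (x) T(V) + T(V) (x) I *)
Definition ideal_tens (I : T -> Prop) (t : T2) : Prop :=
  exists2 s : seq (T * T)%type,
    forall p, p \in s -> I p.1 \/ I p.2 & t = \sum_(p <- s) tensT p.1 p.2.

(* The counit vanishes on I as soon as I lives in positive degree. *)
Definition coideal (I : T -> Prop) : Prop :=
  forall f, I f -> ideal_tens I (comult f).

Definition nichols_admissible (I : T -> Prop) : Prop :=
  [/\ homogeneous_ideal I, in_degree_ge2 I & coideal I].

(* The sum of all admissible ideals, which is the largest one by
   [nichols_ideal_admissible] and [nichols_ideal_largest]. *)
Definition nichols_ideal (f : T) : Prop :=
  exists2 s : seq T,
    forall h, h \in s -> exists2 I, nichols_admissible I & I h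
    & f = \sum_(h <- s) h.

Lemma nichols_ideal_largest I :
  nichols_admissible I -> forall f, I f -> nichols_ideal f.
Proof.
move=> adI f If; exists [:: f]; last by rewrite big_seq1.
by move=> h; rewrite inE => /eqP ->; exists I.
Qed.

Lemma nichols_ideal_ideal : two_sided_ideal nichols_ideal.
Proof.
split.
- by exists [::]; rewrite ?big_nil.
- move=> _ _ [s Hs ->] [t Ht ->]; exists (s ++ t); last by rewrite big_cat.
  by move=> h; rewrite mem_cat => /orP [/Hs|/Ht].
- move=> a _ [s Hs ->]; exists [seq a * h | h <- s].
    move=> _ /mapP [h /Hs [I adI Ih] ->]; exists I => //.
    by have [[[_ _ IMl _] _] _ _] := adI; apply: IMl.
  by rewrite mulr_sumr big_map.
- move=> a _ [s Hs ->]; exists [seq h * a | h <- s].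
    move=> _ /mapP [h /Hs [I adI Ih] ->]; exists I => //.
    by have [[[_ _ _ IMr] _] _ _] := adI; apply: IMr.
  by rewrite mulr_suml big_map.
Qed.

Lemma nichols_ideal_ge2 : in_degree_ge2 nichols_ideal.
Proof.
move=> _ [s Hs ->] w w2; rewrite raddf_sum big_seq big1 //= => h /Hs.
by case=> I [_ I2 _] /I2/(_ w w2).
Qed.

Lemma nichols_ideal_admissible : nichols_admissible nichols_ideal.
Proof.
split; [split; first exact: nichols_ideal_ideal | exact: nichols_ideal_ge2 |].
- move=> _ [s Hs ->] d; exists [seq hom_comp d h | h <- s].
    move=> _ /mapP [h /Hs [I adI Ih] ->]; exists I => //.
    by have [[_ Ih'] _ _] := adI; apply: Ih'.
  by rewrite big_map /hom_comp raddf_sum.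
- move=> _ [s Hs ->].
  elim: s Hs => [|h s IHs] Hs.
    by exists [::]; rewrite // !big_nil /comult raddf0.
  have [|t Ht Et] := IHs.
    by move=> k ks; apply: Hs; rewrite inE ks orbT.
  have [I adI Ih] := Hs h (mem_head _ _).
  have [_ _ /(_ h Ih) [t' Ht' Et']] := adI.
  exists (t' ++ t); last by rewrite big_cons big_cat -Et -Et' /comult raddfD.
  move=> p; rewrite mem_cat => /orP [/Ht'|/Ht //].
  by case=> Ip; [left | right]; exact: nichols_ideal_largest adI _ Ip.
Qed.

Lemma nichols_ideal_proper : ~ nichols_ideal 1.
Proof.
move=> /nichols_ideal_ge2/(_ mone); rewrite fdeg1 => /(_ isT) /eqP.
by rewrite mcoeff1 eqxx oner_eq0.
Qed.

Definition nichols_proper_ideal : proper_ideal (free_alg K n) :=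
  ProperIdeal nichols_ideal_ideal nichols_ideal_proper.

Definition nichols : algType K := quot_alg nichols_proper_ideal.

(* The action of G on T(V) passes to the Nichols algebra. *)

Lemma tens_act_linear x : linear (tens_act x).
Proof. by move=> c f h; apply: mlift_is_linear. Qed.
HB.instance Definition _ x :=
  GRing.isLinear.Build K T T *:%R (tens_act x) (tens_act_linear x).

Lemma comult_linear : linear comult.
Proof. by move=> c f h; apply: mlift_is_linear. Qed.
HB.instance Definition _ :=
  GRing.isLinear.Build K T T2 *:%R comult comult_linear.

Lemma hom_comp_linear d : linear (hom_comp d).
Proof. by move=> c f h; apply: mlift_is_linear. Qed.
HB.instance Definition _ d :=
  GRing.isLinear.Build K T T *:%R (hom_comp d) (hom_comp_linear d).

Definition tens_act2 (x : gT) (t : T2) : T2 :=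
  mlift (fun p => << word_char p.1 x * word_char p.2 x *g p >>) t.
Lemma hom_compU d c w :
  hom_comp d << c *g w >> = if fdeg w == d then << c *g w >> else 0.
Proof.
rewrite /hom_comp mliftU; case: eqP => _; last by rewrite scaler0.
by rewrite malg_scaleU mulr1.
Qed.

Lemma tens_act2_linear x : linear (tens_act2 x).
Proof. by move=> c f h; apply: mlift_is_linear. Qed.
HB.instance Definition _ x :=
  GRing.isLinear.Build K T2 T2 *:%R (tens_act2 x) (tens_act2_linear x).

Lemma tens_actD x f h : tens_act x (f + h) = tens_act x f + tens_act x h.
Proof. exact: linearD. Qed.
Lemma tens_actB x f h : tens_act x (f - h) = tens_act x f - tens_act x h.
Proof. exact: linearB. Qed.
Lemma tens_act0 x : tens_act x 0 = 0.
Proof. exact: linear0. Qed.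
Lemma comultD f h : comult (f + h) = comult f + comult h.
Proof. exact: linearD. Qed.
Lemma comult0 : comult 0 = 0.
Proof. exact: linear0. Qed.
Lemma hom_compD d f h : hom_comp d (f + h) = hom_comp d f + hom_comp d h.
Proof. exact: linearD. Qed.
Lemma hom_comp0 d : hom_comp d 0 = 0.
Proof. exact: linear0. Qed.
Lemma tens_act2D x s t : tens_act2 x (s + t) = tens_act2 x s + tens_act2 x t.
Proof. exact: linearD. Qed.
Lemma tens_act2_0 x : tens_act2 x 0 = 0.
Proof. exact: linear0. Qed.
Lemma tensTDl f f' h : tensT (f + f') h = tensT f h + tensT f' h.
Proof. exact: linearD. Qed.
Lemma tensT0l h : tensT 0 h = 0.
Proof. exact: linear0. Qed.
Lemma tensTDr f h h' : tensT f (h + h') = tensT f h + tensT f h'.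
Proof.
rewrite -[RHS]mlift_funD; apply: eq_mlift => u; exact: linearD.
Qed.
Lemma tensT0r f : tensT f 0 = 0.
Proof.
by apply: (addrI (tensT f 0)); rewrite -tensTDr !addr0.
Qed.
Lemma braided_mulDl s s' t :
  braided_mul (s + s') t = braided_mul s t + braided_mul s' t.
Proof. exact: linearD. Qed.
Lemma braided_mul0l t : braided_mul 0 t = 0.
Proof. exact: linear0. Qed.
Lemma braided_mulDr s t t' :
  braided_mul s (t + t') = braided_mul s t + braided_mul s t'.
Proof.
rewrite -[RHS]mlift_funD; apply: eq_mlift => u; exact: linearD.
Qed.
Lemma braided_mul0r s : braided_mul s 0 = 0.
Proof.
by apply: (addrI (braided_mul s 0)); rewrite -braided_mulDr !addr0.
Qed.

Lemma word_char_one x : word_char mone x = 1.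
Proof. by rewrite /word_char fm1 big_nil. Qed.
Lemma word_charM u v x :
  word_char (mmul u v) x = word_char u x * word_char v x.
Proof. by rewrite /word_char fmM big_cat. Qed.
Lemma word_char_neq0 w x : word_char w x != 0.
Proof.
rewrite /word_char prodf_seq_neq0; apply/allP => i _ /=.
apply/eqP => /(congr1 ( *%R^~ (chi i x^-1%g))).
by rewrite -charM mulgV char1 mul0r; apply/eqP/oner_neq0.
Qed.
Lemma word_char1 w : word_char w 1%g = 1.
Proof. by rewrite /word_char big1 // => i _; rewrite char1. Qed.
Lemma word_charMg w x y : word_char w (x * y)%g = word_char w x * word_char w y.
Proof.
by rewrite /word_char -big_split; apply: eq_bigr => i _; rewrite charM.
Qed.

Lemma tens_actU x c w : tens_act x << c *g w >> = << c * word_char w x *g w >>.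
Proof.
by rewrite /tens_act mliftU malg_scaleU.
Qed.

Lemma mcoeff_tens_act x f w : (tens_act x f)@_w = word_char w x * f@_w.
Proof.
elim/malg_ind: f => [|f h IHf IHh|c u].
- by rewrite tens_act0 mcoeff0 mulr0.
- rewrite tens_actD !mcoeffD mulrDr;
  exact: (congr2 +%R IHf IHh).
rewrite tens_actU; transitivity ((c * word_char u x) *+ (u == w)).
  exact: mcoeffU.
rewrite mcoeffU mulrnAr.
by case: eqP => [->|_]; rewrite ?mulr1n ?mulr0n // mulrC.
Qed.

Lemma tens_act1 f : tens_act 1%g f = f.
Proof. by apply/malgP => w; rewrite mcoeff_tens_act word_char1 mul1r. Qed.

Lemma tens_actMg x y f : tens_act (x * y)%g f = tens_act x (tens_act y f).
Proof.
by apply/malgP => w; rewrite !mcoeff_tens_act word_charMg -mulrA.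
Qed.

Lemma tens_act_monoid_morphism x : monoid_morphism (tens_act x).
Proof.
split=> [|f h].
  by rewrite /= tens_actU word_char_one mulr1.
elim/malg_ind: f => [|f f' IHf IHf'|a u].
- by rewrite mul0r tens_act0 mul0r.
- rewrite mulrDl tens_actD (tens_actD x f f') mulrDl;
  exact: (congr2 +%R IHf IHf').
elim/malg_ind: h => [|h h' IHh IHh'|b v].
- by rewrite mulr0 tens_act0 mulr0.
- rewrite mulrDr tens_actD (tens_actD x h h') mulrDr;
  exact: (congr2 +%R IHh IHh').
apply: etrans (congr1 (tens_act x) (fgmulUU a b u v)) _.
apply: etrans (tens_actU x _ _) _; rewrite word_charM mulrACA.
apply: esym; apply: etrans (congr2 *%R (tens_actU x a u) (tens_actU x b v)) _.
exact: fgmulUU.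
Qed.

Lemma tens_act2U x c p :
  tens_act2 x << c *g p >> = << c * (word_char p.1 x * word_char p.2 x) *g p >>.
Proof.
by rewrite /tens_act2 mliftU malg_scaleU.
Qed.

Lemma tensTU a u b v : tensT << a *g u >> << b *g v >> = << a * b *g (u, v) >>.
Proof. by rewrite /tensT mliftU mliftU !malg_scaleU mulr1. Qed.

Lemma mliftZl (J : choiceType) (V : lmodType K) (h : J -> V) c f :
  mlift (fun k => c *: h k) f = c *: mlift h f.
Proof.
rewrite mlift.unlock scaler_sumr; apply: eq_bigr => k _.
by rewrite !scalerA mulrC.
Qed.

Lemma tens_act2_tensT x f h :
  tens_act2 x (tensT f h) = tensT (tens_act x f) (tens_act x h).
Proof.
elim/malg_ind: f => [|f f' IHf IHf'|a u].
- by rewrite tensT0l tens_act0 tens_act2_0 tensT0l.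
- rewrite tensTDl tens_act2D tens_actD tensTDl;
  exact: (congr2 +%R IHf IHf').
elim/malg_ind: h => [|h h' IHh IHh'|b v].
- by rewrite tensT0r tens_act0 tens_act2_0 tensT0r.
- rewrite tensTDr tens_act2D tens_actD tensTDr;
  exact: (congr2 +%R IHh IHh').
apply: etrans (congr1 (tens_act2 x) (tensTU a u b v)) _.
apply: etrans (tens_act2U x _ _) _; rewrite mulrACA; apply: esym.
apply: etrans (congr2 tensT (tens_actU x a u) (tens_actU x b v)) _.
exact: tensTU.
Qed.

Lemma braided_mulUU a p b q :
  braided_mul << a *g p >> << b *g q >> =
  << a * b * word_char q.1 (word_deg p.2) *g (mmul p.1 q.1, mmul p.2 q.2) >>.
Proof. by rewrite /braided_mul !mliftU !malg_scaleU mulrA. Qed.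

Lemma braided_mulZ a b s t :
  braided_mul (a *: s) (b *: t) = (a * b) *: braided_mul s t.
Proof.
apply: etrans (linearZ _ _) _; rewrite -scalerA; congr (a *: _).
apply: etrans _ (mliftZl _ _ _); apply: eq_mlift => p; exact: linearZ.
Qed.

Lemma tens_act2_braided_mul x s t :
  tens_act2 x (braided_mul s t) = braided_mul (tens_act2 x s) (tens_act2 x t).
Proof.
elim/malg_ind: s => [|s s' IHs IHs'|a p].
- by rewrite braided_mul0l !tens_act2_0 braided_mul0l.
- rewrite braided_mulDl tens_act2D (tens_act2D x s) braided_mulDl;
  exact: (congr2 +%R IHs IHs').
elim/malg_ind: t => [|t t' IHt IHt'|b q].
- by rewrite braided_mul0r !tens_act2_0 braided_mul0r.
- rewrite braided_mulDr tens_act2D (tens_act2D x t) braided_mulDr;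
  exact: (congr2 +%R IHt IHt').
apply: etrans (congr1 (tens_act2 x) (braided_mulUU a p b q)) _.
apply: etrans (tens_act2U x _ _) _; apply: esym.
apply: etrans (congr2 braided_mul (tens_act2U x a p) (tens_act2U x b q)) _.
apply: etrans (braided_mulUU _ _ _ _) _; congr (<< _ *g _ >>).
by rewrite /= !word_charM; ring.
Qed.

Lemma word_charU i x : word_char (fmu i) x = chi i x.
Proof. by rewrite /word_char fmU big_seq1. Qed.

Lemma tens_act2_gen x i :
  tens_act2 x (<< (fmu i, mone) >> + << (mone, fmu i) >>) =
  chi i x *: (<< (fmu i, mone) >> + << (mone, fmu i) >>).
Proof.
apply: etrans (tens_act2D _ _ _) _; apply: etrans _ (esym (scalerDr _ _ _)).
apply: (congr2 +%R); apply: etrans (tens_act2U _ _ _) _.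
all: apply: etrans _ (esym (malg_scaleU _ _ _)); congr (<< _ *g _ >>) => /=.
all: by rewrite word_charU word_char_one mul1r !mulr1 ?mul1r.
Qed.

Lemma tens_act2_comult x f :
  comult (tens_act x f) = tens_act2 x (comult f).
Proof.
elim/malg_ind: f => [|f h IHf IHh|c w].
- by rewrite tens_act0 comult0 tens_act2_0.
- rewrite tens_actD !comultD tens_act2D;
  exact: (congr2 +%R IHf IHh).
apply: etrans (congr1 comult (tens_actU x c w)) _.
apply: etrans (mliftU _ _ _) _.
apply: etrans _ (esym (congr1 (tens_act2 x) (mliftU _ _ _))).
apply: etrans _ (esym (linearZ _ _)); rewrite -scalerA; congr (c *: _).
rewrite /word_char; elim: (w : seq _) => [|i l IH].
  rewrite !big_nil scale1r; apply: etrans _ (esym (tens_act2U _ _ _)).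
  by rewrite /= word_char_one !mulr1.
rewrite !big_cons; apply: etrans _ (esym (tens_act2_braided_mul _ _ _)).
apply: etrans (esym (braided_mulZ _ _ _ _)) _.
exact: (congr2 braided_mul (esym (tens_act2_gen x i)) IH).
Qed.

Lemma nichols_ideal_act x f : nichols_ideal f -> nichols_ideal (tens_act x f).
Proof.
move=> nf; pose I' h := nichols_ideal (tens_act x^-1%g h).
have I'x h : nichols_ideal h -> I' (tens_act x h).
  by rewrite /I' -tens_actMg mulVg tens_act1.
suff adI' : nichols_admissible I'.
  by apply: (nichols_ideal_largest adI'); apply: I'x.
have [[[I0 ID IMl IMr] Ih] I2 Ic] := nichols_ideal_admissible.
split; [split; [split |] | |]; rewrite /I'.
- by rewrite tens_act0.
- by move=> h k; rewrite tens_actD; apply: ID.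
- move=> a h; have [_ ->] := tens_act_monoid_morphism x^-1%g; apply: IMl.
- move=> a h; have [_ ->] := tens_act_monoid_morphism x^-1%g; apply: IMr.
- move=> h I'h d; suff <- : hom_comp d (tens_act x^-1%g h) =
                            tens_act x^-1%g (hom_comp d h) by apply: Ih.
  elim/malg_ind: h {I'h} => [|h k IHh IHk|c w].
  + by rewrite tens_act0 hom_comp0 tens_act0.
  + rewrite tens_actD !hom_compD tens_actD;
    exact: (congr2 +%R IHh IHk).
  apply: etrans (congr1 (hom_comp d) (tens_actU _ c w)) _.
  apply: etrans (hom_compU d _ w) _.
  apply: etrans _ (esym (congr1 (tens_act _) (hom_compU d c w))).
  by case: eqP => _; rewrite ?tens_act0 // tens_actU.
- move=> h I'h w w2; have := I2 _ I'h w w2; rewrite mcoeff_tens_act => /eqP.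
  by rewrite mulf_eq0 (negPf (word_char_neq0 _ _)) => /eqP.
- move=> h /Ic [s Hs Es].
  exists [seq (tens_act x p.1, tens_act x p.2) | p <- s].
    by move=> _ /mapP [p /Hs pI ->] /=; case: pI => /I'x; [left | right].
  rewrite big_map -[h in LHS]tens_act1 -(mulgV x) tens_actMg.
  rewrite tens_act2_comult Es.
  rewrite (big_morph _ (tens_act2D x) (tens_act2_0 x)).
  by apply: eq_bigr => p _; rewrite tens_act2_tensT.
Qed.

Local Notation B := nichols.
Local Notation pi := (quot_pi nichols_proper_ideal).

Definition nichols_act (x : gT) (b : B) : B :=
  pi (tens_act x (quot_repr b)).

Lemma nichols_act_pi x f :
  nichols_act x (pi f) = pi (tens_act x f).
Proof.
apply/quot_piP.
have := @nichols_ideal_act x _ (quot_reprP nichols_proper_ideal f).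
by rewrite tens_actB.
Qed.

Lemma nichols_act_linear x : linear (nichols_act x).
Proof.
move=> c a b.
apply: etrans (congr1 (nichols_act x) (quot_lin_repr _ _ _)) _.
apply: etrans (nichols_act_pi _ _) _.
apply: etrans (congr1 pi (tens_act_linear x c _ _)) _; exact: quot_pi_lin.
Qed.

Lemma nichols_act_mult x : monoid_morphism (nichols_act x).
Proof.
have [t1 tM] := tens_act_monoid_morphism x.
split=> [|a b].
  by apply: etrans (nichols_act_pi x 1) _; apply: etrans (congr1 pi t1) _.
apply: etrans (congr1 (nichols_act x) (quot_mul_repr _ _)) _.
apply: etrans (nichols_act_pi _ _) _.
apply: etrans (congr1 pi (tM _ _)) _; exact: quot_piM.
Qed.

Lemma nichols_act1 a : nichols_act 1%g a = a.
Proof.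
by apply: etrans (congr1 pi (tens_act1 _)) _; apply: quot_reprK.
Qed.

Lemma nichols_actM x y a :
  nichols_act (x * y)%g a = nichols_act x (nichols_act y a).
Proof.
apply: etrans (congr1 pi (tens_actMg _ _ _)) _.
exact: esym (nichols_act_pi _ _).
Qed.

Definition nichols_alg_action : algebra_action gT B :=
  AlgebraAction nichols_act_linear nichols_act_mult nichols_act1 nichols_actM.

(* The algebra underlying the Radford bosonization B(V) # KG *)
Definition nichols_bosonization : algType K := smash_alg nichols_alg_action.

End Nichols.

Section Modules.
Variables (K : fieldType) (A : algType K).

Definition fin_dim_module (M : lmodType A) : Prop :=
  exists d (e : 'I_d -> M), forall m, exists c : 'I_d -> K,
    m = \sum_i (c i)%:A *: e i.

Definition indecomposable (M : lmodType A) : Prop :=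
  (exists m : M, m != 0) /\
  forall P Q : {pred M}, submod_closed P -> submod_closed Q ->
    (forall m, exists2 p, p \in P & exists2 q, q \in Q & m = p + q) ->
    (forall m, m \in P -> m \in Q -> m = 0) ->
    (forall p, p \in P -> p = 0) \/ (forall q, q \in Q -> q = 0).

Definition isomorphic (M N : lmodType A) : Prop :=
  exists f : {linear M -> N}, bijective f.

End Modules.

(* B-A-bimodules over K: the two actions of K coincide. *)
Record bimodule (K : fieldType) (B A : algType K) := Bimodule {
  bimod_left :> lmodType B;
  ract : bimod_left -> A -> bimod_left;
  ract1 : forall f, ract f 1 = f;
  ractM : forall f a a', ract f (a * a') = ract (ract f a) a';
  ractDl : forall f f' a, ract (f + f') a = ract f a + ract f' a;
  ractDr : forall f a a', ract f (a + a') = ract f a + ract f a';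
  ract_scale : forall b f a, ract (b *: f) a = b *: ract f a;
  ract_central : forall (c : K) f, ract f c%:A = c%:A *: f
}.

Section Bimodules.
Variables (K : fieldType) (B A : algType K) (F : bimodule B A).

Definition bimod_fin_gen : Prop :=
  exists d (e : 'I_d -> F), forall f, exists s : seq (B * 'I_d * A),
    f = \sum_(t <- s) t.1.1 *: ract (e t.1.2) t.2.

Definition right_free : Prop :=
  exists (I : choiceType) (e : I -> F), forall f,
    exists! c : {malg A[I]}, f = \sum_(i <- msupp c) ract (e i) c@_i.

(* F (x)_A M is the commutative monoid generated by the pairs (f, m), i.e. the
   finite sequences of such pairs up to permutation, modulo the additivity in
   each variable and (f a, m) ~ (f, a m).  The opposite of (f, m) is (- f, m),
   and b (f, m) = (b f, m). *)
Variable M : lmodType A.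

Inductive tensor_eq : seq (F * M) -> seq (F * M) -> Prop :=
  | tensor_refl s : tensor_eq s s
  | tensor_sym s t : tensor_eq s t -> tensor_eq t s
  | tensor_trans s t u : tensor_eq s t -> tensor_eq t u -> tensor_eq s u
  | tensor_cat s s' t t' : tensor_eq s s' -> tensor_eq t t' ->
      tensor_eq (s ++ t) (s' ++ t')
  | tensor_catC s t : tensor_eq (s ++ t) (t ++ s)
  | tensor_0l m : tensor_eq [:: (0, m)] [::]
  | tensor_Dl f f' m : tensor_eq [:: (f + f', m)] [:: (f, m); (f', m)]
  | tensor_Dr f m m' : tensor_eq [:: (f, m + m')] [:: (f, m); (f, m')]
  | tensor_bal f a m : tensor_eq [:: (ract f a, m)] [:: (f, a *: m)].

Definition tensor_rel (s t : seq (F * M)) : bool := `[< tensor_eq s t >].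

Lemma tensor_rel_equiv : equiv_class_of tensor_rel.
Proof.
split.
- by move=> s; apply/asboolP; apply: tensor_refl.
- by move=> s t; apply/asboolP/asboolP; apply: tensor_sym.
- by move=> s t u /asboolP st /asboolP tu; apply/asboolP/(tensor_trans st tu).
Qed.
Canonical tensor_equiv := EquivRelPack tensor_rel_equiv.
Canonical tensor_encModRel := defaultEncModRel tensor_rel.

Definition tensor : Type := {eq_quot tensor_rel}.
HB.instance Definition _ := Choice.on tensor.

Definition tensor_pi (s : seq (F * M)) : tensor := \pi_{eq_quot tensor_rel} s.
Definition tensor_repr (t : tensor) : seq (F * M) :=
  repr (t : {eq_quot tensor_rel}).

Lemma tensor_reprK t : tensor_pi (tensor_repr t) = t.
Proof. exact: reprK. Qed.

Lemma tensor_piP s t : tensor_pi s = tensor_pi t <-> tensor_eq s t.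
Proof.
by split=> [/eqmodP/asboolP | st]; last by apply/eqmodP/asboolP.
Qed.

Lemma tensor_reprP s : tensor_eq (tensor_repr (tensor_pi s)) s.
Proof. by apply/tensor_piP; rewrite tensor_reprK. Qed.

Definition tensor_zero : tensor := tensor_pi [::].
Definition tensor_add (s t : tensor) : tensor :=
  tensor_pi (tensor_repr s ++ tensor_repr t).
Definition tensor_opp (s : tensor) : tensor :=
  tensor_pi [seq (- p.1, p.2) | p <- tensor_repr s].
Definition tensor_scale (b : B) (s : tensor) : tensor :=
  tensor_pi [seq (b *: p.1, p.2) | p <- tensor_repr s].

Lemma tensor_eq_map (h : F -> F) : (forall x y, h (x + y) = h x + h y) ->
  (forall f a, h (ract f a) = ract (h f) a) -> forall s t, tensor_eq s t ->
  tensor_eq [seq (h p.1, p.2) | p <- s] [seq (h p.1, p.2) | p <- t].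
Proof.
move=> hD hr s t; elim=> {s t} /=.
- by move=> s; apply: tensor_refl.
- by move=> s t _; apply: tensor_sym.
- by move=> s t u _ st _; apply: tensor_trans.
- by move=> s s' t t' _ ss _ tt; rewrite !map_cat; apply: tensor_cat.
- by move=> s t; rewrite !map_cat; apply: tensor_catC.
- move=> m; have -> : h 0 = 0; last exact: tensor_0l.
  by apply: (addrI (h 0)); rewrite -hD !addr0.
- by move=> f f' m; rewrite hD; apply: tensor_Dl.
- by move=> f m m'; apply: tensor_Dr.
- by move=> f a m; rewrite hr; apply: tensor_bal.
Qed.

Lemma tensor_piD s t :
  tensor_pi (s ++ t) = tensor_add (tensor_pi s) (tensor_pi t).
Proof.
by apply/esym/tensor_piP; apply: tensor_cat; apply: tensor_reprP.
Qed.

Lemma ractN f a : ract (- f) a = - ract f a :> F.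
Proof.
have r0 : ract 0 a = 0 :> F.
  by apply: (addrI (ract 0 a)); rewrite -ractDl !addr0.
by apply: (addrI (ract f a)); rewrite -ractDl !subrr.
Qed.

Lemma tensor_piN s :
  tensor_pi [seq (- p.1, p.2) | p <- s] = tensor_opp (tensor_pi s).
Proof.
apply/esym/tensor_piP; apply: (@tensor_eq_map -%R); last exact: tensor_reprP.
  by move=> x y; rewrite opprD.
by move=> f a; rewrite ractN.
Qed.

Lemma tensor_piZ b s :
  tensor_pi [seq (b *: p.1, p.2) | p <- s] = tensor_scale b (tensor_pi s).
Proof.
apply/esym/tensor_piP; apply: (@tensor_eq_map ( *:%R b)).
- by move=> x y; rewrite scalerDr.
- by move=> f a; rewrite ract_scale.
- exact: tensor_reprP.
Qed.

Lemma tensor_addA : associative tensor_add.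
Proof.
move=> x y z; rewrite -[x]tensor_reprK -[y]tensor_reprK -[z]tensor_reprK.
by rewrite -!tensor_piD catA.
Qed.
Lemma tensor_addC : commutative tensor_add.
Proof. by move=> x y; apply/tensor_piP/tensor_catC. Qed.
Lemma tensor_add0 : left_id tensor_zero tensor_add.
Proof. by move=> x; rewrite -[x]tensor_reprK -tensor_piD. Qed.
Lemma tensor_addN : left_inverse tensor_zero tensor_opp tensor_add.
Proof.
move=> x; rewrite -[x]tensor_reprK -tensor_piN -tensor_piD.
apply/tensor_piP; elim: (tensor_repr x) => [|[f m] s IHs] /=.
  exact: tensor_refl.
set s' := map _ _ in IHs *.
rewrite -[(f, m) :: s]cat1s -cat_cons catA.
apply: tensor_trans (tensor_cat (tensor_catC _ _) (tensor_refl _)) _.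
rewrite -[_ ++ s]/([:: (f, m); (- f, m)] ++ (s' ++ s)).
apply: (@tensor_cat _ [::] _ [::]) IHs.
apply: (tensor_trans (tensor_sym (tensor_Dl _ _ _))).
by rewrite subrr; apply: tensor_0l.
Qed.

HB.instance Definition _ := GRing.isZmodule.Build tensor
  tensor_addA tensor_addC tensor_add0 tensor_addN.

Lemma tensor_scaleA a b x :
  tensor_scale a (tensor_scale b x) = tensor_scale (a * b) x.
Proof.
rewrite -[x]tensor_reprK -!tensor_piZ -map_comp; congr tensor_pi.
by apply: eq_map => p /=; rewrite scalerA.
Qed.
Lemma tensor_scale1 : left_id 1 tensor_scale.
Proof.
move=> x; rewrite -[x]tensor_reprK -!tensor_piZ; congr tensor_pi.
by rewrite -[RHS]map_id; apply: eq_map => -[f m] /=; rewrite scale1r.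
Qed.
Lemma tensor_scaleDr : right_distributive tensor_scale +%R.
Proof.
move=> b x y; rewrite -[x]tensor_reprK -[y]tensor_reprK.
by rewrite /GRing.add /= -tensor_piD -!tensor_piZ map_cat tensor_piD.
Qed.
Lemma tensor_scaleDl x : {morph tensor_scale^~ x : a b / a + b}.
Proof.
move=> a b; rewrite -[x]tensor_reprK -!tensor_piZ.
elim: (tensor_repr x) => [|[f m] s IHs] /=; first by rewrite addr0.
rewrite -cat1s -[(a *: f, m) :: _]cat1s -[(b *: f, m) :: _]cat1s.
have piD s' t' : tensor_pi (s' ++ t') = tensor_pi s' + tensor_pi t'.
  exact: tensor_piD.
rewrite !piD IHs addrACA; congr (_ + _); rewrite -piD scalerDl.
by apply/tensor_piP; apply: tensor_Dl.
Qed.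

HB.instance Definition _ := GRing.Zmodule_isLmodule.Build B tensor
  tensor_scaleA tensor_scale1 tensor_scaleDr tensor_scaleDl.

End Bimodules.

(* The algebra B is not assumed to be finite dimensional, hence the condition
   that F (x) - preserves finite dimension, which is automatic if B is. *)
Definition wild (K : fieldType) (B : algType K) : Prop :=
  exists F : bimodule B (free_alg K 2),
    [/\ bimod_fin_gen F,
        right_free F,
        forall M, fin_dim_module M -> fin_dim_module (tensor F M),
        forall M, fin_dim_module M ->
          indecomposable M -> indecomposable (tensor F M)
      & forall M N, fin_dim_module M -> fin_dim_module N ->
          isomorphic (tensor F M) (tensor F N) -> isomorphic M N].

(* Main.v *)
(* Fix two generators x = x_i, y = x_j and q = chi_j(g_i).  As chi_i(g_i) and
   chi_j(g_j) are not -1, a degree 2 relation of B(V) becomes a multiple of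
   x y - q y x when the other generators are set to 0, so every matrix solution of
   x y = q y x in which all triple products vanish is a representation of B(V).

   Given a C<X,Y>-module T, let W = T + x T + y T + z T with y x t = z t,
   x y t = q z t, x^2 t = z X t and y^2 t = z Y t.  From W one recovers T as the
   top of W and X as the composite of x^2 : top W -> rad^2 W with the inverse of
   y x : top W -> rad^2 W, and likewise Y.  This W is compatible with the action
   of G when T is graded with X and Y of degrees 1 and -1; so, given a
   C<a,b>-module M, take T = M^3 with X : e_0 -> e_1 -> e_2 -> 0 and
   Y : e_1 -> a e_0, e_2 -> b e_1.  Every homomorphism between two such modules W,
   even one that ignores the grading, induces a map on M = T / X T that commutes
   with a and b.  An idempotent endomorphism inducing 0 on M is 0, so
   indecomposability is preserved and isomorphism reflected, for B(V) and for its
   bosonization at the same time. *)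

From HB Require Import structures.
Require Import Defs.
From mathcomp Require Import all_boot all_order all_algebra fingroup.
From mathcomp Require Import boolp reals complex finmap monalg.

Set Implicit Arguments.
Unset Strict Implicit.
Unset Printing Implicit Defensive.

Import GRing.Theory.
Local Open Scope ring_scope.

(** * Bimodules from matrix representations *)

(** Columns over [M] with [B] acting through [rho], that is, [F ⊗_A M] in coordinates for the
    bimodule [F] of columns over [A]. The carrier does not mention [rho]; the parameter attaches the
    action to the type. *)
Definition rep_mod (K : fieldType) (A B : algType K) (n : nat)
  (rho : {rmorphism B -> 'M[A]_n.+1}) (M : lmodType A) : Type :=
  {ffun 'I_n.+1 -> M}.

Section RepModule.
Variables (K : fieldType) (A B : algType K) (n : nat).
Variables (rho : {rmorphism B -> 'M[A]_n.+1}) (M : lmodType A).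
Local Notation W := (rep_mod rho M).

HB.instance Definition _ := GRing.Zmodule.on W.

Definition rep_scale (b : B) (w : W) : W :=
  [ffun i => \sum_j rho b i j *: w j].

Lemma rep_scaleA a b w : rep_scale a (rep_scale b w) = rep_scale (a * b) w.
Proof.
apply/ffunP => i; rewrite !ffunE rmorphM.
under eq_bigr => j _ do rewrite ffunE scaler_sumr.
rewrite exchange_big; apply: eq_bigr => k _ /=.
by rewrite mxE scaler_suml; apply: eq_bigr => j _; rewrite scalerA.
Qed.

Lemma rep_scale1 : left_id 1 rep_scale.
Proof.
move=> w; apply/ffunP => i; rewrite ffunE rmorph1 (bigD1 i) //= big1 => [|j ji].
  by rewrite mxE eqxx scale1r addr0.
by rewrite mxE eq_sym (negPf ji) scale0r.
Qed.

Lemma rep_scaleDr : right_distributive rep_scale +%R.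
Proof.
move=> b v w; apply/ffunP => i; rewrite !ffunE -big_split /=.
by apply: eq_bigr => j _; rewrite ffunE scalerDr.
Qed.

Lemma rep_scaleDl w : {morph rep_scale^~ w : a b / a + b}.
Proof.
move=> a b; apply/ffunP => i; rewrite !ffunE -big_split /=.
by apply: eq_bigr => j _; rewrite rmorphD mxE scalerDl.
Qed.

HB.instance Definition _ := GRing.Zmodule_isLmodule.Build B W
  rep_scaleA rep_scale1 rep_scaleDr rep_scaleDl.

Lemma rep_scaleE (b : B) (w : W) i : (b *: w) i = \sum_j rho b i j *: w j.
Proof. by rewrite ffunE. Qed.

Definition rep_delta (k : 'I_n.+1) (m : M) : W := [ffun i => m *+ (i == k)].

Lemma rep_delta_sum (w : W) : w = \sum_k rep_delta k (w k).
Proof.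
apply/ffunP => i; rewrite sum_ffunE (bigD1 i) //= big1 => [|j ji].
  by rewrite ffunE eqxx addr0.
by rewrite ffunE eq_sym (negPf ji).
Qed.

Lemma rep_deltaD k m m' : rep_delta k (m + m') = rep_delta k m + rep_delta k m'.
Proof. by apply/ffunP => i; rewrite !ffunE mulrnDl. Qed.

Lemma rep_delta0 k : rep_delta k 0 = 0.
Proof. by apply/ffunP => i; rewrite !ffunE mul0rn. Qed.

Lemma rep_delta_sumr k (J : Type) (r : seq J) (F : J -> M) :
  rep_delta k (\sum_(j <- r) F j) = \sum_(j <- r) rep_delta k (F j).
Proof. exact: (big_morph _ (rep_deltaD k) (rep_delta0 k)). Qed.

Hypothesis rhoK : forall c : K, rho c%:A = (c%:A)%:M.

Lemma rep_scaleK (c : K) (w : W) i : ((c%:A : B) *: w) i = (c%:A : A) *: w i.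
Proof.
rewrite rep_scaleE rhoK (bigD1 i) //= big1 => [|j ji].
  by rewrite mxE eqxx mulr1n addr0.
by rewrite mxE eq_sym (negPf ji) scale0r.
Qed.

Lemma rep_scaleK_delta (c : K) k m :
  (c%:A : B) *: rep_delta k m = rep_delta k ((c%:A : A) *: m).
Proof. by apply/ffunP => i; rewrite rep_scaleK !ffunE scalerMnr. Qed.

(** Copies of a spanning family of [M], one in each coordinate, span over [K], because by [rhoK]
    scalars act coordinatewise. *)
Lemma rep_mod_fin_dim : fin_dim_module M -> fin_dim_module W.
Proof.
case=> d [e He].
pose E (p : 'I_n.+1 * 'I_d) := rep_delta p.1 (e p.2).
exists #|{: 'I_n.+1 * 'I_d}|, (fun i => E (enum_val i)) => w.
have [c Hc] := choice (fun k => He (w k)).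
exists (fun i => let p := enum_val i in c p.1 p.2).
transitivity (\sum_(p : 'I_n.+1 * 'I_d) (c p.1 p.2)%:A *: E p); last first.
  by rewrite big_enum_val.
rewrite -(pair_bigA _ (fun k i => (c k i)%:A *: E (k, i))) /=.
rewrite [w in LHS]rep_delta_sum; apply: eq_bigr => k _.
rewrite {1}(Hc k) rep_delta_sumr; apply: eq_bigr => i _.
by rewrite rep_scaleK_delta.
Qed.

End RepModule.

(** * The bimodule of columns over [A] and tensor products with it *)

Section RepBimodule.
Variables (K : fieldType) (A B : algType K) (n : nat).
Variables (rho : {rmorphism B -> 'M[A]_n.+1}).
Hypothesis rhoK : forall c : K, rho c%:A = (c%:A)%:M.
Local Notation W := (rep_mod rho).

Definition rep_ract (f : W A^o) (a : A) : W A^o := [ffun i => f i * a].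

Lemma rep_ract1 f : rep_ract f 1 = f.
Proof. by apply/ffunP => i; rewrite ffunE mulr1. Qed.
Lemma rep_ractM f a a' : rep_ract f (a * a') = rep_ract (rep_ract f a) a'.
Proof. by apply/ffunP => i; rewrite !ffunE mulrA. Qed.
Lemma rep_ractDl f f' a :
  rep_ract (f + f') a = rep_ract f a + rep_ract f' a.
Proof. by apply/ffunP => i; rewrite !ffunE mulrDl. Qed.
Lemma rep_ractDr f a a' :
  rep_ract f (a + a') = rep_ract f a + rep_ract f a'.
Proof. by apply/ffunP => i; rewrite !ffunE mulrDr. Qed.
Lemma rep_ract_scale b f a : rep_ract (b *: f) a = b *: rep_ract f a.
Proof.
apply/ffunP => i; rewrite ffunE !rep_scaleE mulr_suml.
by apply: eq_bigr => j _; rewrite ffunE [in RHS]/GRing.scale /= mulrA.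
Qed.
Lemma rep_ract_central (c : K) f : rep_ract f c%:A = (c%:A : B) *: f.
Proof.
apply/ffunP => i; rewrite ffunE rep_scaleK // /GRing.scale /=.
by rewrite mulr_algl mulr_algr.
Qed.

Definition rep_bimodule : bimodule B A :=
  Bimodule rep_ract1 rep_ractM rep_ractDl rep_ractDr rep_ract_scale
    rep_ract_central.
Local Notation F := rep_bimodule.
Local Notation unitv k := (rep_delta rho k (1 : A^o)).

Lemma rep_ract_delta k (a : A) :
  rep_ract (unitv k) a = rep_delta rho k (a : A^o).
Proof.
by apply/ffunP => i; rewrite !ffunE; case: eqP; rewrite ?mul1r ?mul0r.
Qed.

Lemma rep_bimodule_fin_gen : bimod_fin_gen F.
Proof.
exists n.+1, (fun k => unitv k : F) => f.
exists [seq (1, k, f k) | k <- index_enum 'I_n.+1].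
rewrite big_map [LHS]rep_delta_sum; apply: eq_bigr => k _ /=.
by rewrite scale1r rep_ract_delta.
Qed.

Lemma rep_ract_sum (c : {malg A['I_n.+1]}) :
  \sum_(i <- msupp c) rep_ract (unitv i) c@_i = [ffun j => c@_j] :> W A^o.
Proof.
apply/ffunP => j; rewrite sum_ffunE ffunE.
under eq_bigr => i _ do rewrite rep_ract_delta ffunE.
have [jc|jc] := boolP (j \in msupp c); last first.
  rewrite (mcoeff_outdom jc) big_seq big1 // => i ic.
  by case: eqP ic jc => // <- ->.
rewrite (big_fsetD1 j) //= eqxx big_seq big1 ?addr0 // => i.
by rewrite !inE => /andP[/negPf ij _]; rewrite eq_sym ij.
Qed.

Lemma rep_bimodule_free : right_free F.
Proof.
exists 'I_n.+1, (fun k => unitv k : F) => f.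
exists (\sum_i << (f i : A) *g i >>); split=> [|c ->].
  rewrite /= rep_ract_sum; apply/ffunP => j; rewrite ffunE raddf_sum /=.
  rewrite (bigD1 j) //= big1 => [|i /negPf ij]; rewrite mcoeffU ?ij //.
  by rewrite eqxx addr0.
rewrite /= rep_ract_sum; apply/malgP => j; rewrite raddf_sum /=.
rewrite (bigD1 j) //= big1 => [|i /negPf ij]; rewrite mcoeffU ?ij //.
by rewrite eqxx addr0 ffunE.
Qed.

Section Tensor.
Variable M : lmodType A.

(** The canonical isomorphism from [F ⊗_A M] to columns over [M], on a pure tensor; [tensor_of]
    below is its inverse. *)
Definition tens_eval (p : F * M) : W M := [ffun i => (p.1 i : A) *: p.2].

Definition seq_eval (s : seq (F * M)) : W M := \sum_(p <- s) tens_eval p.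

Lemma seq_eval_cat s t : seq_eval (s ++ t) = seq_eval s + seq_eval t.
Proof. exact: big_cat. Qed.

Lemma seq_eval_eq s t : tensor_eq s t -> seq_eval s = seq_eval t.
Proof.
elim=> {s t} //.
- by move=> s t u _ -> _.
- by move=> s s' t t' _ ss _ tt; rewrite !seq_eval_cat ss tt.
- by move=> s t; rewrite !seq_eval_cat addrC.
- move=> m; rewrite /seq_eval big_cons !big_nil addr0.
  by apply/ffunP => i; rewrite !ffunE scale0r.
- move=> f f' m; rewrite /seq_eval !big_cons !big_nil !addr0.
  by apply/ffunP => i; rewrite !ffunE scalerDl.
- move=> f m m'; rewrite /seq_eval !big_cons !big_nil !addr0.
  by apply/ffunP => i; rewrite !ffunE scalerDr.
- move=> f a m; rewrite /seq_eval !big_cons !big_nil !addr0.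
  by apply/ffunP => i; rewrite !ffunE /= scalerA.
Qed.

Definition tensor_eval (t : tensor F M) : W M := seq_eval (tensor_repr t).

Lemma tensor_evalE s : tensor_eval (tensor_pi s) = seq_eval s.
Proof. exact/seq_eval_eq/tensor_reprP. Qed.

Lemma tensor_eval_linear : linear tensor_eval.
Proof.
move=> b s t; rewrite -[s]tensor_reprK -[t]tensor_reprK.
have -> : b *: tensor_pi (tensor_repr s) + tensor_pi (tensor_repr t) =
  tensor_pi ([seq (b *: p.1, p.2) | p <- tensor_repr s] ++ tensor_repr t).
  rewrite tensor_piD; congr (_ + _); exact/esym/tensor_piZ.
rewrite !tensor_evalE seq_eval_cat; congr (_ + _).
rewrite /seq_eval big_map scaler_sumr; apply: eq_bigr => p _.
apply/ffunP => i; rewrite [LHS]ffunE !rep_scaleE /= scaler_suml.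
by apply: eq_bigr => j _; rewrite ffunE scalerA.
Qed.

HB.instance Definition _ := GRing.isLinear.Build B (tensor F M) (W M) *:%R
  tensor_eval tensor_eval_linear.

Definition tensor_of (w : W M) : tensor F M :=
  \sum_k tensor_pi [:: (unitv k : F, w k)].

Lemma tensor_of_eval : cancel tensor_eval tensor_of.
Proof.
have piDl (f f' : F) (m : M) : tensor_pi [:: (f + f', m)] =
    tensor_pi [:: (f, m)] + tensor_pi [:: (f', m)].
  by rewrite -[RHS]tensor_piD; apply/tensor_piP/tensor_Dl.
have piDr (f : F) (m m' : M) : tensor_pi [:: (f, m + m')] =
    tensor_pi [:: (f, m)] + tensor_pi [:: (f, m')].
  by rewrite -[RHS]tensor_piD; apply/tensor_piP/tensor_Dr.
have pi0l (m : M) : tensor_pi [:: (0 : F, m)] = 0.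
  exact/tensor_piP/tensor_0l.
have pi0r (f : F) : tensor_pi [:: (f, 0 : M)] = 0.
  by apply: (addrI (tensor_pi [:: (f, 0 : M)])); rewrite -piDr !addr0.
have ofD v w : tensor_of (v + w) = tensor_of v + tensor_of w.
  by rewrite -big_split; apply: eq_bigr => k _; rewrite ffunE piDr.
have of0 : tensor_of 0 = 0.
  by rewrite /tensor_of big1 // => k _; rewrite ffunE pi0r.
move=> t; rewrite -[t]tensor_reprK tensor_evalE.
elim: (tensor_repr t) => [|[f m] s IHs].
  by rewrite /seq_eval big_nil of0.
rewrite /seq_eval big_cons ofD IHs -cat1s [RHS]tensor_piD.
(* Expand [f] in the basis of columns; balancing then moves each coefficient [f k] across the tensor
   sign. *)
congr (_ + _); rewrite [f in RHS](rep_delta_sum (f : W A^o)).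
rewrite (big_morph (fun f => tensor_pi [:: (f : F, m)])
           (fun f f' => piDl f f' m) (pi0l m)).
apply: eq_bigr => k _; rewrite ffunE /= -(rep_ract_delta k (f k)).
apply/tensor_piP/tensor_sym; exact: (@tensor_bal _ _ _ F).
Qed.

Lemma tensor_eval_of : cancel tensor_of tensor_eval.
Proof.
move=> w; rewrite linear_sum [RHS]rep_delta_sum; apply: eq_bigr => k _.
rewrite /= tensor_evalE /seq_eval big_seq1; apply/ffunP => i; rewrite !ffunE /=.
by case: (i == k); rewrite ?mulr1n ?mulr0n ?scale1r ?scale0r.
Qed.

End Tensor.
End RepBimodule.

(** * Indecomposability through idempotents *)

Section Idempotents.
Variables (K : fieldType) (A : algType K) (M : lmodType A).

(** A decomposition into [P] and [Q] yields the projection onto [P] along [Q], an idempotent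
    endomorphism; if it is 0 or the identity, one summand vanishes. *)
Lemma idempotent_indecomposable : (exists m : M, m != 0) ->
  (forall e : M -> M, linear e -> (forall m, e (e m) = e m) ->
     (forall m, e m = 0) \/ (forall m, e m = m)) ->
  indecomposable M.
Proof.
move=> M0 idem; split=> // P Q [P0 Plin] [Q0 Qlin] PQ PQ0.
have subP p p' : p \in P -> p' \in P -> p - p' \in P.
  by move=> Pp Pp'; rewrite addrC -scaleN1r; apply: Plin.
have subQ p p' : p \in Q -> p' \in Q -> p - p' \in Q.
  by move=> Pp Pp'; rewrite addrC -scaleN1r; apply: Qlin.
have ex m : exists p, (p \in P) && (m - p \in Q).
  have [p Pp [q Qq ->]] := PQ m.
  by exists p; rewrite Pp addrC addKr.
have [e He] := choice ex.
have eP m : e m \in P by case/andP: (He m).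
have eQ m : m - e m \in Q by case/andP: (He m).
(* Since [P] and [Q] meet only in 0, the component in [P] is unique; linearity and idempotence of
   the chosen [e] follow from this. *)
have euniq m p : p \in P -> m - p \in Q -> e m = p.
  move=> Pp Qp; apply/subr0_eq/PQ0; first exact: subP.
  have -> : e m - p = (m - p) - (m - e m).
    by rewrite opprB [RHS]addrC addrA subrK.
  exact: subQ.
have elin : linear e.
  move=> a u v; apply: euniq; first exact: Plin.
  by rewrite opprD addrACA -scalerBr; apply: Qlin.
have ee m : e (e m) = e m.
  by apply: euniq => //; rewrite subrr // -(subrr (m - e m)); apply: subQ.
have [e0|e1] := idem e elin ee.
- left=> p Pp; rewrite -(e0 p); apply/esym/euniq => //.
  by rewrite subrr -(subrr (p - e p)); apply: subQ.
- by right=> q Qq; rewrite -(e1 q); apply: euniq; rewrite ?subr0.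
Qed.

(** The fixed points and the kernel of an idempotent are complementary submodules. *)
Lemma indecomposable_idempotent : indecomposable M ->
  forall e : M -> M, linear e -> (forall m, e (e m) = e m) ->
    (forall m, e m = 0) \/ (forall m, e m = m).
Proof.
move=> [_ indM] e elin ee.
have eB : zmod_morphism e := zmod_morphism_linear elin.
have e0 : e 0 = 0 by have := eB 0 0; rewrite !subrr.
case: (indM [pred m | e m == m] [pred m | e m == 0]).
- split=> [|a u v]; rewrite !inE ?e0 // => /eqP eu /eqP ev.
  by rewrite elin eu ev.
- split=> [|a u v]; rewrite !inE ?e0 // => /eqP eu /eqP ev.
  by rewrite elin eu ev scaler0 addr0.
- move=> m; exists (e m); first by rewrite inE ee.
  by exists (m - e m); rewrite ?inE ?eB ?ee ?subrr // addrC subrK.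
- by move=> m; rewrite !inE => /eqP -> /eqP.
- by move=> H; left=> m; apply: H; rewrite inE ee.
- move=> H; right=> m; apply/esym/subr0_eq/H.
  by rewrite inE eB ee subrr.
Qed.

End Idempotents.

(** * A criterion for wildness: homomorphisms and idempotents seen at one coordinate *)

Section WildCriterion.
Variables (K : fieldType) (B : algType K) (n : nat).
Local Notation A := (free_alg K 2).
Variables (rho : {rmorphism B -> 'M[A]_n.+1}) (k0 : 'I_n.+1).
Local Notation W := (rep_mod rho).
Hypothesis rhoK : forall c : K, rho c%:A = (c%:A)%:M.

(** The two conditions say that coordinate [k0] carries a map on [M] induced by every homomorphism,
    and that this map detects whether an idempotent is 0. *)
Hypothesis rep_top : forall (M N : lmodType A) (f : W M -> W N), linear f ->
  exists2 h : M -> N, linear h & forall w, f w k0 = h (w k0).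
Hypothesis rep_idempotent0 : forall (M : lmodType A) (e : W M -> W M),
  linear e -> (forall w, e (e w) = e w) -> (forall w, e w k0 = 0) ->
  forall w, e w = 0.

Local Notation F := (rep_bimodule rhoK).
Local Notation ev M := (@tensor_eval _ _ _ _ _ rhoK M).
Local Notation of_ M := (@tensor_of _ _ _ _ _ rhoK M).

Let tensor_of_linear M : linear (of_ M).
Proof.
move=> b v w; apply: (can_inj (@tensor_of_eval _ _ _ _ _ rhoK M)).
by rewrite linearP /= !tensor_eval_of.
Qed.

Let conj_linear M N (f : tensor F M -> tensor F N) :
  linear f -> linear (fun w => ev N (f (of_ M w))).
Proof. by move=> flin b v w; rewrite tensor_of_linear flin linearP. Qed.

Let tensor_fin_dim M : fin_dim_module M -> fin_dim_module (tensor F M).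
Proof.
move=> /(rep_mod_fin_dim rhoK) [d [e He]].
exists d, (fun i => of_ M (e i)) => t.
have [c Ht] := He (ev M t); exists c.
apply: (can_inj (@tensor_of_eval _ _ _ _ _ rhoK M)).
rewrite linear_sum Ht /=; apply: eq_bigr => i _.
by rewrite linearZ /= tensor_eval_of.
Qed.

(** An idempotent on the tensor product induces an idempotent [h] on [M], which is 0 or 1. In the
    first case the idempotent itself is 0, in the second its complement is. *)
Let tensor_indecomposable M : indecomposable M -> indecomposable (tensor F M).
Proof.
move=> indM; apply: idempotent_indecomposable => [|e elin ee].
  have [[m m0] _] := indM; exists (of_ M (rep_delta rho k0 m)).
  apply: contra m0 => /eqP/(congr1 (ev M)).
  rewrite tensor_eval_of linear0 => /ffunP/(_ k0).
  by rewrite !ffunE eqxx mulr1n => ->.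
pose e' w := ev M (e (of_ M w)).
have e'lin : linear e' by apply: conj_linear.
have e'e' w : e' (e' w) = e' w by rewrite /e' tensor_of_eval ee.
have eE t : e t = of_ M (e' (ev M t)) by rewrite /e' !tensor_of_eval.
have of0 : of_ M 0 = 0.
  apply: (can_inj (@tensor_of_eval _ _ _ _ _ rhoK M)).
  by rewrite tensor_eval_of linear0.
have [h hlin hE] := rep_top e'lin.
have hh m : h (h m) = h m.
  have := congr1 (fun w : W M => w k0) (e'e' (rep_delta rho k0 m)).
  by rewrite /= !hE !ffunE eqxx.
have [h0|h1] := indecomposable_idempotent indM hlin hh.
  left=> t; rewrite eE rep_idempotent0 // => w.
  by rewrite hE h0.
right=> t; rewrite eE.
suff -> : e' (ev M t) = ev M t by rewrite tensor_of_eval.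
(* The complementary idempotent induces [1 - h = 0] at coordinate [k0]. *)
apply/esym/subr0_eq; pose e2 w := w - e' w.
have e'B : zmod_morphism e' := zmod_morphism_linear e'lin.
apply: (@rep_idempotent0 _ e2).
- move=> b u v; rewrite /e2 e'lin scalerBr opprD addrACA //.
- by move=> w; rewrite /e2 e'B e'e' subrr subr0.
by move=> w; rewrite /e2 !ffunE hE h1 subrr.
Qed.

Let tensor_isomorphic M N :
  isomorphic (tensor F M) (tensor F N) -> isomorphic M N.
Proof.
case=> f [f' fK f'K].
have f'lin : linear f' by exact: (can2_linear fK f'K).
have [h hlin hE] := rep_top (conj_linear (linearP f)).
have [h' h'lin h'E] := rep_top (conj_linear f'lin).
pose H := GRing.isLinear.Build _ _ _ _ h hlin.
pose hL : {linear M -> N} := HB.pack h H.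
(* The maps induced by [f] and its inverse are mutually inverse: evaluate both composites on the
   vector with entry [m] at [k0]. *)
exists hL; exists h' => m.
  have := h'E (ev N (f (of_ M (rep_delta rho k0 m)))).
  rewrite hE tensor_of_eval fK tensor_eval_of !ffunE eqxx mulr1n; exact: esym.
have := hE (ev M (f' (of_ N (rep_delta rho k0 m)))).
rewrite h'E tensor_of_eval f'K tensor_eval_of !ffunE eqxx mulr1n; exact: esym.
Qed.

Lemma rep_wild : wild B.
Proof.
exists F; split=> [|||M _|M N _ _].
- exact: rep_bimodule_fin_gen.
- exact: rep_bimodule_free.
- exact: tensor_fin_dim.
- exact: tensor_indecomposable.
- exact: tensor_isomorphic.
Qed.

End WildCriterion.

(** * Induction on elements of the free algebra *)

Section FreeAlgebraInduction.
Variables (K : comNzRingType) (n : nat).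
Local Notation T := (free_alg K n).
Local Notation gen i := (<< fmu i >> : T).

Lemma fmonom_cons (i : 'I_n) l : FMonom (i :: l) = mmul (fmu i) (FMonom l).
Proof. by apply: val_inj; rewrite /= fmM fmU. Qed.

Lemma fmonom_nil : FMonom [::] = mone :> {fmonom 'I_n}.
Proof. by apply: val_inj; rewrite /= fm1. Qed.

Lemma free_algU_cons c i l :
  << c *g FMonom (i :: l) >> = gen i * << c *g FMonom l >> :> T.
Proof.
by rewrite fmonom_cons; apply/esym/(etrans (fgmulUU _ _ _ _)); rewrite mul1r.
Qed.

Lemma free_algU_nil c : << c *g FMonom [::] >> = c%:A :> T.
Proof. by rewrite fmonom_nil [RHS]malg_scaleU mulr1. Qed.

Lemma free_alg_word_ind (P : T -> Prop) :
  P 0 -> (forall f h, P f -> P h -> P (f + h)) ->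
  (forall c l, P << c *g FMonom l >>) -> forall f, P f.
Proof. by move=> P0 PD PU; apply: malg_ind => // c [l]. Qed.

Lemma free_alg_ind (P : T -> Prop) :
  (forall f h, P f -> P h -> P (f + h)) -> (forall c, P c%:A) ->
  (forall i f, P f -> P (gen i * f)) -> forall f, P f.
Proof.
move=> PD PC PM; apply: free_alg_word_ind => //.
  by rewrite -(scale0r (1 : T)).
move=> c l; elim: l => [|i l IHl]; first by rewrite free_algU_nil.
by rewrite free_algU_cons; apply: PM.
Qed.

(** Linearity over the free algebra need only be tested on scalars and generators. *)
Lemma free_alg_linear (M N : lmodType T) (h : M -> N) :
  (forall u v, h (u + v) = h u + h v) ->
  (forall (c : K) u, h ((c%:A : T) *: u) = (c%:A : T) *: h u) ->
  (forall i u, h (gen i *: u) = gen i *: h u) -> linear h.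
Proof.
move=> hD hK hgen f u v; rewrite hD; congr (_ + _).
elim/free_alg_ind: f u => [f f' IHf IHf'|c|i f IHf] u //.
- by rewrite !scalerDl hD IHf IHf'.
- by rewrite -!scalerA hgen IHf.
Qed.

End FreeAlgebraInduction.

(** * The module of rank 12 *)

Notation ord12 k := (@Ordinal 12 k isT).

Section TwelveDim.
Variables (K : fieldType) (A : algType K) (q : K) (a b : A).

(* For k < 3 the basis vectors are numbered e_k = k, x e_k = 3 + k, y e_k = 6 + k
   and z_k = y x e_k = 9 + k.  The matrices act by x y e_k = q z_k and
   x^2 e_0 = z_1, x^2 e_1 = z_2, x^2 e_2 = 0,
   y^2 e_0 = 0, y^2 e_1 = a z_0, y^2 e_2 = b z_1. *)
Definition mx_x : 'M[A]_12 := \matrix_(i, j)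
  if (i : nat, j : nat) \in [:: (3, 0); (4, 1); (5, 2); (10, 3); (11, 4)]%N
  then 1
  else if (i : nat, j : nat) \in [:: (9, 6); (10, 7); (11, 8)]%N then q%:A
  else 0.

Definition mx_y : 'M[A]_12 := \matrix_(i, j)
  if (i : nat, j : nat) \in
     [:: (6, 0); (7, 1); (8, 2); (9, 3); (10, 4); (11, 5)]%N
  then 1
  else if (i : nat, j : nat) == (9, 7)%N then a
  else if (i : nat, j : nat) == (10, 8)%N then b
  else 0.

(** Case analysis with literal indices carrying the proof [isT], on which matches and matrix entries
    compute. *)
Lemma ord12_ind (P : 'I_12 -> Prop) :
  P (ord12 0) -> P (ord12 1) -> P (ord12 2) -> P (ord12 3) ->
  P (ord12 4) -> P (ord12 5) -> P (ord12 6) -> P (ord12 7) ->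
  P (ord12 8) -> P (ord12 9) -> P (ord12 10) -> P (ord12 11) ->
  forall i, P i.
Proof.
move=> p0 p1 p2 p3 p4 p5 p6 p7 p8 p9 p10 p11 [m mlt].
by do 12! [case: m mlt => [|m] mlt //;
  first by rewrite (bool_irrelevance mlt isT)].
Qed.

Lemma big_ord12 (V : nmodType) (F : 'I_12 -> V) : \sum_j F j =
  F (ord12 0) + (F (ord12 1) + (F (ord12 2) + (F (ord12 3) +
  (F (ord12 4) + (F (ord12 5) + (F (ord12 6) + (F (ord12 7) +
  (F (ord12 8) + (F (ord12 9) + (F (ord12 10) + F (ord12 11))))))))))).
Proof.
rewrite !big_ord_recl big_ord0 addr0.
do 11! [congr (_ + _); first by congr F; apply: val_inj].
by congr F; apply: val_inj.
Qed.

Variables (M : lmodType A) (w : 'I_12 -> M).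

Lemma mx_x_act i : \sum_j mx_x i j *: w j =
  match i : nat with
  | 3 => w (ord12 0) | 4 => w (ord12 1) | 5 => w (ord12 2)
  | 9 => q%:A *: w (ord12 6)
  | 10 => w (ord12 3) + q%:A *: w (ord12 7)
  | 11 => w (ord12 4) + q%:A *: w (ord12 8)
  | _ => 0
  end.
Proof.
elim/ord12_ind: i; rewrite big_ord12 !mxE /= ?scale0r ?scale1r ?add0r ?addr0 //.
all: by rewrite ?add0r ?addr0.
Qed.

Lemma mx_y_act i : \sum_j mx_y i j *: w j =
  match i : nat with
  | 6 => w (ord12 0) | 7 => w (ord12 1) | 8 => w (ord12 2)
  | 9 => w (ord12 3) + a *: w (ord12 7)
  | 10 => w (ord12 4) + b *: w (ord12 8)
  | 11 => w (ord12 5)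
  | _ => 0
  end.
Proof.
elim/ord12_ind: i; rewrite big_ord12 !mxE /= ?scale0r ?scale1r ?add0r ?addr0 //.
all: by rewrite ?add0r ?addr0.
Qed.

End TwelveDim.

(** * Homomorphisms and idempotents of the modules of rank 12 *)

Section TwelveDimWild.
Variables (K : fieldType) (B : algType K) (q : K) (X Y : B).
Local Notation A := (free_alg K 2).
Local Notation a := (<< fmu (0 : 'I_2) >> : A).
Local Notation b := (<< fmu (1 : 'I_2) >> : A).
Variable rho : {rmorphism B -> 'M[A]_12}.
Hypothesis rhoK : forall c : K, rho c%:A = (c%:A)%:M.
Hypothesis rhoX : rho X = mx_x A q.
Hypothesis rhoY : rho Y = mx_y a b.
Local Notation W := (rep_mod rho).
Local Notation delta k := (rep_delta rho (ord12 k)).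
Local Notation cd w k := ((w : {ffun _ -> _}) (ord12 k)).

Section Action.
Variable M : lmodType A.
Implicit Types (w : W M) (m : M).

Lemma actX w i : (X *: w) i = \sum_j mx_x A q i j *: w j.
Proof. by rewrite rep_scaleE rhoX. Qed.

Lemma actY w i : (Y *: w) i = \sum_j mx_y a b i j *: w j.
Proof. by rewrite rep_scaleE rhoY. Qed.

Lemma actYX w i : ((Y * X) *: w) i =
  match i : nat with
  | 9 => cd w 0 | 10 => cd w 1 | 11 => cd w 2 | _ => 0
  end.
Proof.
rewrite -scalerA actY mx_y_act !actX !mx_x_act.
by elim/ord12_ind: i; rewrite /= ?scaler0 ?addr0.
Qed.

Lemma actXX w i : ((X * X) *: w) i =
  match i : nat with
  | 10 => cd w 0 | 11 => cd w 1 | _ => 0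
  end.
Proof.
rewrite -scalerA actX mx_x_act !actX !mx_x_act.
by elim/ord12_ind: i; rewrite /= ?scaler0 ?addr0.
Qed.

Lemma actYY w i : ((Y * Y) *: w) i =
  match i : nat with
  | 9 => a *: cd w 1 | 10 => b *: cd w 2 | _ => 0
  end.
Proof.
rewrite -scalerA actY mx_y_act !actY !mx_y_act.
by elim/ord12_ind: i; rewrite /= ?scaler0 ?add0r.
Qed.

Let deg2E := (actYX, actXX, actYY).

(** The vectors z_1 and z_2 lie in the image of x^2, as x^2 e_0 and x^2 e_1. This identity and the
    next four involve only the action of elements of [B], so every homomorphism respects them. *)
Lemma actYX_split w :
  (Y * X) *: w = (Y * X) *: delta 0 (cd w 0) +
                 (X * X) *: (delta 0 (cd w 1) + delta 1 (cd w 2)).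
Proof.
apply/ffunP => i; rewrite [RHS]ffunE !deg2E.
by elim/ord12_ind: i; rewrite /= ?ffunE /= ?mulr1n ?mulr0n ?addr0 ?add0r.
Qed.

Lemma actYX1 m : (Y * X) *: delta 1 m = (X * X) *: delta 0 m.
Proof.
by apply/ffunP => i; rewrite !deg2E; elim/ord12_ind: i; rewrite /= ?ffunE.
Qed.

Lemma actYX2 m : (Y * X) *: delta 2 m = (X * X) *: delta 1 m.
Proof.
by apply/ffunP => i; rewrite !deg2E; elim/ord12_ind: i; rewrite /= ?ffunE.
Qed.

Lemma actYX_a m : (Y * X) *: delta 0 (a *: m) = (Y * Y) *: delta 1 m.
Proof.
apply/ffunP => i; rewrite !deg2E.
by elim/ord12_ind: i; rewrite /= ?ffunE //= mulr0n scaler0.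
Qed.

Lemma actYX_b m : (Y * X) *: delta 1 (b *: m) = (Y * Y) *: delta 2 m.
Proof.
apply/ffunP => i; rewrite !deg2E.
by elim/ord12_ind: i; rewrite /= ?ffunE //= mulr0n scaler0.
Qed.

Lemma rad_split w : cd w 0 = 0 -> cd w 1 = 0 -> cd w 2 = 0 ->
  exists u v : W M, w = X *: u + Y *: v.
Proof.
move=> w0 w1 w2.
(* [X *: u] supplies the coordinates at x e_k, and [Y *: v] those at y e_k and z_k. The default 0 of
   [nth] suppresses the terms with [q], [a] and [b]. *)
pose u := [ffun i : 'I_12 => nth 0 [:: cd w 3; cd w 4; cd w 5] i].
pose v := [ffun i : 'I_12 => nth 0
  [:: cd w 6; cd w 7; cd w 8; cd w 9; cd w 10; cd w 11] i].
exists (u : W M), (v : W M); apply/ffunP => i.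
rewrite [RHS]ffunE actX actY mx_x_act mx_y_act.
by elim/ord12_ind: i; rewrite /= ?ffunE /= ?scaler0 ?addr0 ?add0r.
Qed.

End Action.

Section Hom.
Variables (M N : lmodType A) (f : W M -> W N).
Hypothesis flin : linear f.

Let fD u v : f (u + v) = f u + f v.
Proof. by have := flin 1 u v; rewrite !scale1r. Qed.
Let fZ c u : f (c *: u) = c *: f u.
Proof. exact: (scalable_linear flin). Qed.

Definition hom_top (m : M) : N := cd (f (delta 0 m)) 0.

(* Read off the coordinate at e_0 as the coordinate of y x f(w) at z_0, to which
   x^2 does not contribute. *)
Lemma hom_topE w : cd (f w) 0 = hom_top (cd w 0).
Proof.
have <- : cd ((Y * X) *: f w) 9 = cd (f w) 0 by rewrite actYX.
by rewrite -fZ actYX_split fD !fZ ffunE actYX actXX addr0.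
Qed.

(** Both sides are the z_1 coordinate of [f] applied to y x e_1 = x^2 e_0. Thus x^2 transports the
    induced map from e_0 to e_1, and then likewise to e_2. *)
Lemma hom_top1 m : cd (f (delta 1 m)) 1 = hom_top m.
Proof.
have <- : cd ((Y * X) *: f (delta 1 m)) 10 = cd (f (delta 1 m)) 1.
  by rewrite actYX.
by rewrite -fZ actYX1 fZ actXX.
Qed.

Lemma hom_top2 m : cd (f (delta 2 m)) 2 = hom_top m.
Proof.
have <- : cd ((Y * X) *: f (delta 2 m)) 11 = cd (f (delta 2 m)) 2.
  by rewrite actYX.
by rewrite -fZ actYX2 fZ actXX hom_top1.
Qed.

(** Commutation with [a] comes from y x (a e_0) = y^2 e_1 and with [b] from y x (b e_1) = y^2 e_2,
    using that [f] induces the same map at e_0, e_1 and e_2. *)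
Lemma hom_top_linear : linear hom_top.
Proof.
apply: free_alg_linear => [u v|c u|i u].
- by rewrite /hom_top rep_deltaD fD ffunE.
- by rewrite /hom_top -rep_scaleK_delta // fZ rep_scaleK.
have [->|->] : i = 0 \/ i = 1.
  by case: i => -[|[|[]]] // H; [left | right]; apply: val_inj.
- have -> : hom_top (a *: u) = cd ((Y * X) *: f (delta 0 (a *: u))) 9.
    by rewrite actYX.
  by rewrite -fZ actYX_a fZ actYY /= hom_top1.
- rewrite -hom_top1.
  have <- : cd ((Y * X) *: f (delta 1 (b *: u))) 10 =
            cd (f (delta 1 (b *: u))) 1 by rewrite actYX.
  by rewrite -fZ actYX_b fZ actYY /= hom_top2.
Qed.

End Hom.

(* The image of e is a direct summand P contained in the radical of W, hence
   P = rad P and P = 0. *)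
Lemma idempotent_top0 M (e : W M -> W M) : linear e ->
  (forall w, e (e w) = e w) -> (forall w, cd (e w) 0 = 0) ->
  forall w, e w = 0.
Proof.
move=> elin ee e0.
have eD u v : e (u + v) = e u + e v by have := elin 1 u v; rewrite !scale1r.
have eZ c u : e (c *: u) = c *: e u by exact: (scalable_linear elin).
have h0 m : hom_top e m = 0 by apply: e0.
(* As [e w] has no e_0 coordinate, y x (e w) is x^2 times a vector; applying [e] again reduces its
   z_1 coordinate to an e_0 coordinate of an image of [e]. *)
have e1 w : cd (e w) 1 = 0.
  rewrite -ee; have <- : cd ((Y * X) *: e (e w)) 10 = cd (e (e w)) 1.
    by rewrite actYX.
  rewrite -eZ actYX_split e0 rep_delta0 scaler0 add0r eZ actXX.
  exact: e0.
have e2 w : cd (e w) 2 = 0.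
  rewrite -ee; have <- : cd ((Y * X) *: e (e w)) 11 = cd (e (e w)) 2.
    by rewrite actYX.
  rewrite -eZ actYX_split e0 e1 !rep_delta0 scaler0 !add0r eZ actXX.
  by rewrite /= hom_top1.
(* Applying [e] to a decomposition in the radical keeps [e w] fixed and puts both components in the
   image of [e], so vanishing climbs one layer at a time. *)
have split w : exists u v, e w = X *: e u + Y *: e v.
  have [u [v E]] := rad_split (e0 w) (e1 w) (e2 w).
  by exists u, v; rewrite -!eZ -eD -E ee.
have e3to8 w (i : 'I_12) : (i < 9)%N -> e w i = 0.
  have [u [v ->]] := split w.
  rewrite ffunE actX actY mx_x_act mx_y_act.
  by elim/ord12_ind: i => //= _; rewrite ?e0 ?e1 ?e2 addr0.
move=> w; have [u [v ->]] := split w.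
apply/ffunP => i; rewrite ffunE actX actY mx_x_act mx_y_act [RHS]ffunE.
by elim/ord12_ind: i; rewrite /= ?e3to8 ?scaler0 ?addr0.
Qed.

Lemma wild_of_mx_x_mx_y : wild B.
Proof.
apply: (@rep_wild _ _ _ rho (ord12 0) rhoK).
- move=> M N f flin; exists (hom_top f); first exact: hom_top_linear.
  exact: hom_topE.
- exact: idempotent_top0.
Qed.

End TwelveDimWild.

(** * Representations of free, quotient and smash product algebras *)

Section FreeRepresentation.
Variables (K : fieldType) (A : algType K) (n m : nat).
Variable P : 'I_n -> 'M[A]_m.+1.
Local Notation T := (free_alg K n).
Local Notation gen i := (<< fmu i >> : T).

Definition word_mx (w : seq 'I_n) : 'M[A]_m.+1 := \prod_(i <- w) P i.

(** The extension is made entry by entry because it is linear over [K], whereas matrices over [A]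
    are scaled by [A]. *)
Definition free_rep (f : T) : 'M[A]_m.+1 :=
  \matrix_(r, s) mlift (fun w : {fmonom 'I_n} => word_mx w r s) f.

Lemma free_repE f r s :
  free_rep f r s = mlift (fun w : {fmonom 'I_n} => word_mx w r s) f.
Proof. exact: mxE. Qed.

Lemma free_repU c l r s : free_rep << c *g FMonom l >> r s = c *: word_mx l r s.
Proof. by rewrite free_repE mliftU. Qed.

Lemma free_repB : zmod_morphism free_rep.
Proof.
move=> f h; apply/matrixP => r s; rewrite !mxE.
exact: linearB.
Qed.

Lemma free_repD f h : free_rep (f + h) = free_rep f + free_rep h.
Proof. by apply/matrixP => r s; rewrite !mxE; apply: linearD. Qed.

Lemma free_rep_scalar (c : K) : free_rep c%:A = (c%:A)%:M.
Proof.
rewrite -free_algU_nil; apply/matrixP => r s.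
rewrite free_repU /word_mx big_nil !mxE.
by case: (r == s); rewrite ?mulr1n ?mulr0n ?scaler0.
Qed.

HB.instance Definition _ :=
  GRing.isZmodMorphism.Build T 'M[A]_m.+1 free_rep free_repB.

Lemma free_rep_genM i f : free_rep (gen i * f) = P i * free_rep f.
Proof.
elim/free_alg_word_ind: f => [|f h IHf IHh|c l].
- by rewrite mulr0 raddf0 mulr0.
- by rewrite mulrDr !free_repD mulrDr; exact: (congr2 +%R IHf IHh).
rewrite -free_algU_cons; apply/matrixP => r s.
rewrite free_repU /word_mx big_cons mxE scaler_sumr mxE.
by apply: eq_bigr => k _; rewrite free_repU scalerAr.
Qed.

Lemma free_rep_gen i : free_rep (gen i) = P i.
Proof.
have -> : gen i = gen i * (1%:A : T) by rewrite scale1r mulr1.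
rewrite free_rep_genM free_rep_scalar scale1r.
by rewrite (_ : 1%:M = 1) // mulr1.
Qed.

Lemma alg_scalar_mxC (c : K) (Q : 'M[A]_m.+1) :
  (c%:A)%:M * Q = Q * (c%:A)%:M.
Proof.
rewrite -diag_const_mx; apply/matrixP => r s.
rewrite [_ * _ in RHS]mul_mx_diag [_ * _ in LHS]mul_diag_mx !mxE.
by rewrite mulr_algl mulr_algr.
Qed.

Lemma free_rep_scalarM (c : K) f : free_rep (c *: f) = (c%:A)%:M * free_rep f.
Proof.
apply/matrixP => r s; rewrite [_ * _](mul_scalar_mx) [RHS]mxE !free_repE.
by rewrite linearZ /= mulr_algl.
Qed.

Lemma free_rep_genZM c i f :
  free_rep ((<< c *g fmu i >> : T) * f) = (c%:A)%:M * (P i * free_rep f).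
Proof.
have -> : << c *g fmu i >> = c *: gen i :> T by rewrite [RHS]malg_scaleU mulr1.
by rewrite -scalerAl free_rep_scalarM free_rep_genM.
Qed.

Lemma free_rep_monoid : monoid_morphism free_rep.
Proof.
split=> [|f h].
  by rewrite -[1 in LHS](scale1r (1 : T)) free_rep_scalar scale1r.
elim/free_alg_ind: f => [f f' IHf IHf'|c|i f IHf].
- by rewrite mulrDl !free_repD mulrDl; exact: (congr2 +%R IHf IHf').
- by rewrite free_rep_scalar -scalerAl mul1r free_rep_scalarM.
- rewrite -(mulrA (gen i)).
  apply: etrans (free_rep_genM i (f * h)) _.
  apply: etrans (congr1 ( *%R (P i)) IHf) _; rewrite mulrA.
  exact: (congr1 ( *%R^~ _) (esym (free_rep_genM i f))).
Qed.

HB.instance Definition _ :=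
  GRing.isMonoidMorphism.Build T 'M[A]_m.+1 free_rep free_rep_monoid.

Hypothesis P3 : forall i j k, P i * (P j * P k) = 0.

(** Words of length at least 3 act by 0, and those of length below 2 do not occur in [f]. *)
Lemma free_rep_deg2 f r s :
  (forall w, (fdeg w < 2)%N -> f@_w = 0) ->
  free_rep f r s = \sum_i \sum_j f@_(FMonom [:: i; j]) *: (P i * P j) r s.
Proof.
move=> f2.
suff -> : free_rep f r s = f@_(FMonom [::]) *: word_mx [::] r s +
    \sum_i f@_(FMonom [:: i]) *: P i r s +
    \sum_i \sum_j f@_(FMonom [:: i; j]) *: (P i * P j) r s.
  rewrite f2 // scale0r add0r big1 ?add0r // => i _.
  by rewrite f2 // scale0r.
elim/free_alg_word_ind: f {f2} => [|f h IHf IHh|c l].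
- rewrite raddf0 mxE mcoeff0 scale0r add0r big1 => [|i _].
    rewrite add0r big1 // => i _; rewrite big1 // => j _.
    by rewrite mcoeff0 scale0r.
  by rewrite mcoeff0 scale0r.
- rewrite free_repD mxE IHf IHh mcoeffD scalerDl.
  under [in RHS]eq_bigr => i _ do rewrite mcoeffD scalerDl.
  under [X in _ = _ + X]eq_bigr => i _.
    under eq_bigr => j _ do rewrite mcoeffD scalerDl.
    rewrite big_split /=; over.
  by rewrite !big_split /= addrACA [X in X + _ = _]addrACA.
have mU k : << c *g FMonom l >>@_(FMonom k) = c *+ (l == k) by rewrite mcoeffU.
under eq_bigr => i _ do rewrite mU.
under [X in _ = _ + X]eq_bigr => i _ do under eq_bigr => j _ do rewrite mU.
rewrite mU free_repU; case: l {mU} => [|i [|j [|k l]]] /=.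
- rewrite mulr1n big1 ?addr0 => [|i _]; last by rewrite scale0r.
  by rewrite big1 ?addr0 // => i _; rewrite big1 // => j _; rewrite scale0r.
- rewrite mulr0n scale0r add0r (bigD1 i) //= eqxx mulr1n big1 => [|j ji].
    rewrite addr0 big1 ?addr0 => [|j _]; first by rewrite /word_mx big_seq1.
    by rewrite big1 // => k _; rewrite eqseq_cons andbF scale0r.
  by rewrite eqseq_cons eq_sym (negPf ji) scale0r.
- rewrite mulr0n scale0r add0r big1 ?add0r => [|k _]; last first.
    by rewrite eqseq_cons andbF scale0r.
  rewrite (bigD1 i) //= [X in _ + X]big1 => [|k ki]; last first.
    by rewrite big1 // => k' _; rewrite eqseq_cons eq_sym (negPf ki) scale0r.
  rewrite addr0 (bigD1 j) //= eqxx mulr1n big1 => [|k kj].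
    by rewrite addr0 /word_mx !big_cons big_nil mulr1.
  by rewrite !eqseq_cons eqxx eq_sym (negPf kj) scale0r.
- rewrite /word_mx !big_cons !mulrA -(mulrA (P i)) P3 mul0r mxE scaler0.
  rewrite mulr0n scale0r add0r big1 ?add0r => [|k' _]; last first.
    by rewrite eqseq_cons andbF scale0r.
  rewrite big1 // => i' _; rewrite big1 // => j' _.
  by rewrite !eqseq_cons !andbF scale0r.
Qed.

End FreeRepresentation.

Lemma quot_pi_scalar (K : fieldType) (A : algType K) (I : Defs.proper_ideal A)
    (c : K) : quot_pi I c%:A = c%:A.
Proof. by rewrite linearZ. Qed.

Lemma quot_lift (K : fieldType) (A : algType K) (I : Defs.proper_ideal A)
    (S : nzRingType) (f : {rmorphism A -> S}) : (forall x, I x -> f x = 0) ->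
  exists h : {rmorphism quot_alg I -> S}, forall x, h (quot_pi I x) = f x.
Proof.
move=> fI.
pose h (x : quot_alg I) := f (quot_repr x).
have hE x : h (quot_pi I x) = f x.
  by apply/subr0_eq; rewrite -rmorphB; apply/fI/quot_reprP.
have hB : zmod_morphism h.
  by move=> x y; rewrite -[x]quot_reprK -[y]quot_reprK -raddfB !hE raddfB.
have hM : monoid_morphism h.
  split=> [|x y]; first by rewrite -(rmorph1 f) -hE.
  by rewrite -[x]quot_reprK -[y]quot_reprK -rmorphM !hE rmorphM.
pose H1 := GRing.isZmodMorphism.Build _ _ h hB.
pose H2 := GRing.isMonoidMorphism.Build _ _ h hM.
pose hM' : {rmorphism quot_alg I -> S} := HB.pack h H1 H2.
by exists hM'.
Qed.

(** A covariant pair, namely a representation [f] of [A] and a multiplicative [D] on the group that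
    implements the action, extends to the smash product by b x ↦ f(b) D(x). *)
Lemma smash_lift (K : fieldType) (gT : finGroupType) (A : algType K)
    (act : algebra_action gT A) (S : nzRingType) (f : {rmorphism A -> S})
    (D : gT -> S) : D 1%g = 1 -> (forall x y, D (x * y)%g = D x * D y) ->
  (forall x b, f (act x b) * D x = D x * f b) ->
  exists h : {rmorphism smash_alg act -> S},
    forall b, h (smash_elt act b 1%g) = f b.
Proof.
move=> D1 DM Dact.
pose h (t : smash_alg act) := \sum_x f (t x) * D x.
have hE b x : h (smash_elt act b x) = f b * D x.
  rewrite /h (bigD1 x) //= big1 => [|y /negPf yx]; rewrite ffunE.
    by rewrite eqxx mulr1n addr0.
  by rewrite yx mulr0n rmorph0 mul0r.
have hB : zmod_morphism h.
  move=> t u; rewrite /h -sumrB; apply: eq_bigr => x _.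
  by rewrite !ffunE rmorphB mulrBl.
have hM : monoid_morphism h.
  split=> [|t u]; first by rewrite (hE 1 1%g) rmorph1 D1 mul1r.
  rewrite /h; under eq_bigr => z _ do rewrite ffunE rmorph_sum mulr_suml.
  rewrite exchange_big mulr_suml; apply: eq_bigr => x _ /=.
  rewrite mulr_sumr (reindex_inj (mulgI x)); apply: eq_bigr => y _ /=.
  rewrite mulKg rmorphM DM -!mulrA; congr (_ * _).
  by rewrite !mulrA Dact.
pose H1 := GRing.isZmodMorphism.Build _ _ h hB.
pose H2 := GRing.isMonoidMorphism.Build _ _ h hM.
pose hM' : {rmorphism smash_alg act -> S} := HB.pack h H1 H2.
exists hM' => b.
by rewrite /= hE D1 mulr1.
Qed.

Lemma smash_scalar (K : fieldType) (gT : finGroupType) (A : algType K)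
    (act : algebra_action gT A) (c : K) :
  c%:A = smash_elt act c%:A 1%g.
Proof. by apply/ffunP => x; rewrite !ffunE scalerMnr. Qed.

(** * Relations of degree 2 in a Nichols algebra *)

Section NicholsDegree2.
Variables (K : fieldType) (gT : finGroupType) (n : nat).
Variables (g : 'I_n -> gT) (chi : 'I_n -> character K gT).
Local Notation word := {fmonom 'I_n}.
Local Notation T := {malg K[word]}.

Lemma mcoeff_tensT (f h : T) (u v : word) : (tensT f h)@_(u, v) = f@_u * h@_v.
Proof.
elim/malg_ind: f => [|f f' IHf IHf'|c w].
- by rewrite tensT0l !mcoeff0 mul0r.
- by rewrite tensTDl !mcoeffD IHf IHf' mulrDl.
elim/malg_ind: h => [|h h' IHh IHh'|d w'].
- by rewrite tensT0r !mcoeff0 mulr0.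
- by rewrite tensTDr !mcoeffD IHh IHh' mulrDr.
rewrite tensTU !mcoeffU xpair_eqE.
by case: eqP; case: eqP; rewrite ?mulr1n ?mulr0n ?mulr0 ?mul0r.
Qed.

Lemma braided_mul_genU k c (u v : word) :
  braided_mul g chi (<< (fmu k, mone) >> + << (mone, fmu k) >>)
    << c *g (u, v) >> =
  << c *g (mmul (fmu k) u, v) >> +
  << c * word_char chi u (g k) *g (u, mmul (fmu k) v) >>.
Proof.
apply: etrans (braided_mulDl _ _ _ _ _) _; apply: (congr2 +%R).
all: apply: etrans (braided_mulUU _ _ _ _ _ _) _.
- by rewrite /= mul1m mul1r /word_deg fm1 big_nil word_char1 mulr1.
- by rewrite /= mul1m mul1r /word_deg fmU big_seq1.
Qed.

(** The factor [chi l (g k)] comes from braiding x_k past x_l in (1 ⊗ x_k)(x_l ⊗ 1). *)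
Lemma comult_word2 c k l :
  comult g chi << c *g FMonom [:: k; l] >> =
  c *: ((<< (FMonom [:: k; l], mone) >> + << (fmu k, fmu l) >>) +
        (<< chi l (g k) *g (fmu l, fmu k) >> +
         << (mone, FMonom [:: k; l]) >>)).
Proof.
apply: etrans (mliftU _ _ _) _; congr (_ *: _).
rewrite /= !big_cons big_nil.
have E : braided_mul g chi (<< (fmu l, mone) >> + << (mone, fmu l) >>)
    << (mone, mone) >> = << (fmu l, mone) >> + << (mone, fmu l) >>.
  apply: etrans (braided_mul_genU _ _ _ _) _.
  by rewrite !mulm1 mul1r word_char_one.
apply: etrans (congr1 (braided_mul _ _ _) E) _.
apply: etrans (braided_mulDr _ _ _ _ _) _.
apply: etrans
  (congr2 +%R (braided_mul_genU _ _ _ _) (braided_mul_genU _ _ _ _)) _.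
rewrite !mulm1 !mul1r word_charU word_char_one !fmonom_cons fmonom_nil mulm1.
exact: addrACA.
Qed.

Lemma fmu_eqE (i j : 'I_n) : (fmu i == fmu j) = (i == j).
Proof. by rewrite !fmuE -val_eqE /= eqseq_cons andbT. Qed.

Lemma fmonom2_eqE (i j k l : 'I_n) :
  (FMonom [:: i; j] == FMonom [:: k; l]) = (i == k) && (j == l).
Proof. by rewrite -val_eqE /= !eqseq_cons andbT. Qed.

Lemma mcoeff_comult_hom2 (f : T) i j :
  (comult g chi (hom_comp 2 f))@_(fmu i, fmu j) =
  f@_(FMonom [:: i; j]) + chi i (g j) * f@_(FMonom [:: j; i]).
Proof.
elim/malg_ind: f => [|f h IHf IHh|c [l]].
- by rewrite hom_comp0 comult0 !mcoeff0 mulr0 addr0.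
- by rewrite hom_compD comultD !mcoeffD IHf IHh mulrDr addrACA.
rewrite hom_compU !mcoeffU; case: eqP => [|l2]; last first.
  have lN i' j' : (FMonom l == FMonom [:: i'; j']) = false.
    by apply/eqP => -[E]; case: l2; rewrite fdegE E.
  by rewrite comult0 mcoeff0 !lN !mulr0n mulr0 addr0.
rewrite fdegE /=; case: l => [|k [|l []]] // _.
apply: etrans (congr1 (mcoeff _) (comult_word2 c k l)) _.
apply: etrans (mcoeffZ _ _ _) _.
have coefD4 (p q r s : {malg K[(word * word)%type]}) w :
    (p + q + (r + s))@_w = p@_w + q@_w + (r@_w + s@_w) by rewrite !mcoeffD.
apply: etrans (congr1 ( *%R c) (coefD4 _ _ _ _ _)) _.
apply: etrans (congr1 ( *%R c) (congr2 +%R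
  (congr2 +%R (mcoeffU _ _ _) (mcoeffU _ _ _))
  (congr2 +%R (mcoeffU _ _ _) (mcoeffU _ _ _)))) _.
have m1 i' : (mone == fmu i' :> word) = false.
  by apply/eqP => /(congr1 (@fdeg _)); rewrite fdeg1 fdegU.
rewrite !xpair_eqE !fmu_eqE !fmonom2_eqE.
rewrite !m1 andbF mulr0n add0r addr0 mulrDr mulr_natr; congr (_ + _).
rewrite [(k == j) && _]andbC.
case: eqP => [->|_]; case: eqP => [->|_]; rewrite ?mulr0n ?mulr0 //.
by rewrite !mulr1n mulrC.
Qed.

(** The left side is the coefficient of x_i ⊗ x_j in the coproduct of the degree 2 part of [f]. It
    vanishes since I ⊗ T + T ⊗ I has no component in bidegree (1, 1), the ideal I having no part in
    degree 1. *)
Lemma nichols_ideal_deg2 f i j : nichols_ideal g chi f ->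
  f@_(FMonom [:: i; j]) + chi i (g j) * f@_(FMonom [:: j; i]) = 0.
Proof.
have [[_ Ih] I2 Ic] := nichols_ideal_admissible g chi.
move=> /Ih/(_ 2)/Ic [s Hs Es]; rewrite -mcoeff_comult_hom2 Es.
rewrite raddf_sum big_seq big1 //= => p /Hs Ip.
apply: etrans (mcoeff_tensT _ _ _ _) _.
by case: Ip => /I2 ->; rewrite ?fdegU ?mul0r ?mulr0.
Qed.

End NicholsDegree2.

(** * Relations between the matrices of rank 12, and their grading *)

Section TwelveDimMatrices.
Variables (K : fieldType) (A : algType K) (q : K) (a b : A).
Local Notation x := (mx_x A q).
Local Notation y := (mx_y a b).

Lemma mx_x_mul (Q : 'M[A]_12) r s : (x * Q) r s =
  match r : nat with
  | 3 => Q (ord12 0) s | 4 => Q (ord12 1) s | 5 => Q (ord12 2) s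
  | 9 => q%:A * Q (ord12 6) s
  | 10 => Q (ord12 3) s + q%:A * Q (ord12 7) s
  | 11 => Q (ord12 4) s + q%:A * Q (ord12 8) s
  | _ => 0
  end.
Proof. by rewrite mxE; apply: (@mx_x_act _ _ q A^o (fun j => Q j s)). Qed.

Lemma mx_y_mul (Q : 'M[A]_12) r s : (y * Q) r s =
  match r : nat with
  | 6 => Q (ord12 0) s | 7 => Q (ord12 1) s | 8 => Q (ord12 2) s
  | 9 => Q (ord12 3) s + a * Q (ord12 7) s
  | 10 => Q (ord12 4) s + b * Q (ord12 8) s
  | 11 => Q (ord12 5) s
  | _ => 0
  end.
Proof. by rewrite mxE; apply: (@mx_y_act _ _ a b A^o (fun j => Q j s)). Qed.

Lemma mx_xy r s : (x * y) r s = q *: (y * x) r s.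
Proof.
rewrite -mulr_algl mx_x_mul mx_y_mul.
by elim/ord12_ind: r; rewrite !mxE /= ?mulr0 ?addr0 ?add0r.
Qed.

(** A product of two of these matrices reads only the coordinates at e_0, e_1, e_2, and these rows
    of [P3] are zero. *)
Lemma mx_deg3 P1 P2 P3 : P1 \in [:: x; y] -> P2 \in [:: x; y] ->
  P3 \in [:: x; y] -> P1 * (P2 * P3) = 0.
Proof.
move=> H1 H2 H3.
have Q0 (k : 'I_12) s : (k < 3)%N -> P3 k s = 0.
  by move: H3; rewrite !inE => /orP[] /eqP ->; elim/ord12_ind: k => // _;
    rewrite mxE.
apply/matrixP => r s; transitivity (0 : A); last by rewrite mxE.
move: H1 H2; rewrite !inE => /orP[] /eqP -> /orP[] /eqP ->.
all: elim/ord12_ind: r; rewrite ?mx_x_mul ?mx_y_mul /= ?mx_x_mul ?mx_y_mul /=.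
all: by rewrite ?Q0 ?mulr0 ?addr0.
Qed.

(* The bidegree of the ith basis vector, where e_k has degree (k, 2 - k) and x, y
   have degrees (1, 0) and (0, 1); the shift by (0, 2) keeps it nonnegative. *)
Definition deg_x (i : nat) : nat :=
  nth 0 [:: 0; 1; 2; 1; 2; 3; 0; 1; 2; 1; 2; 3]%N i.
Definition deg_y (i : nat) : nat :=
  nth 0 [:: 2; 1; 0; 2; 1; 0; 3; 2; 1; 3; 2; 1]%N i.

Definition torus_mx (u v : K) : 'M[A]_12 :=
  diag_mx (\row_i (u ^+ deg_x i * v ^+ deg_y i)%:A).

Lemma torus_mx1 : torus_mx 1 1 = 1.
Proof.
by apply/matrixP => r s; rewrite !mxE !expr1n mulr1 scale1r.
Qed.

Lemma torus_mxM u v u' v' :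
  torus_mx (u * u') (v * v') = torus_mx u v * torus_mx u' v'.
Proof.
apply/matrixP => r s; rewrite [_ * _ in RHS]mul_diag_mx !mxE !exprMn.
case: eqP => [->|_]; rewrite ?mulr0 // !mulr1n -scalerAl mul1r scalerA.
by congr (_ *: _); rewrite mulrACA.
Qed.

(** A matrix all of whose nonzero entries change the weight by the factor [c] is homogeneous, so
    conjugation by the torus multiplies it by [c]. *)
Lemma torus_mx_comm (c u v : K) (P : 'M[A]_12) :
  (forall r s, P r s != 0 -> u ^+ deg_x r * v ^+ deg_y r =
     c * (u ^+ deg_x s * v ^+ deg_y s)) ->
  torus_mx u v * P = (c%:A)%:M * (P * torus_mx u v).
Proof.
move=> HP; apply/matrixP => r s.
rewrite [_ * _ in LHS]mul_diag_mx [_ * _ in RHS]mul_scalar_mx.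
rewrite [P * _]mul_mx_diag !mxE.
have [->|Prs] := eqVneq (P r s) 0; first by rewrite mul0r !mulr0.
by rewrite (HP r s) // mulr_algl mulr_algr mulr_algl scalerA.
Qed.

Lemma torus_mx_x u v : torus_mx u v * x = (u%:A)%:M * (x * torus_mx u v).
Proof.
apply: torus_mx_comm => r s; rewrite mxE => Prs.
suff /andP[/eqP -> /eqP ->] : (deg_x r == (deg_x s).+1) && (deg_y r == deg_y s).
  by rewrite exprS mulrA.
(* The degree condition is decided by evaluation on the list of positions of nonzero entries. *)
pose ok p := (deg_x p.1 == (deg_x p.2).+1) && (deg_y p.1 == deg_y p.2).
move: Prs; case: ifP => [H _|_].
  by apply: (elimT (@allP _ ok _) _ _ H).
case: ifP => [H _|_]; last by rewrite eqxx.
by apply: (elimT (@allP _ ok _) _ _ H).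
Qed.

Lemma torus_mx_y u v : torus_mx u v * y = (v%:A)%:M * (y * torus_mx u v).
Proof.
apply: torus_mx_comm => r s; rewrite mxE => Prs.
suff /andP[/eqP -> /eqP ->] : (deg_x r == deg_x s) && (deg_y r == (deg_y s).+1).
  by rewrite exprS mulrCA.
pose ok p := (deg_x p.1 == deg_x p.2) && (deg_y p.1 == (deg_y p.2).+1).
move: Prs; case: ifP => [H _|_].
  by apply: (elimT (@allP _ ok _) _ _ H).
case: ifP => [/eqP[-> ->] //|_]; case: ifP => [/eqP[-> ->] //|_].
by rewrite eqxx.
Qed.

End TwelveDimMatrices.

Lemma sum_support2 (V : nmodType) (I : finType) (i j : I) (F : I -> V) :
  i != j -> (forall k, k != i -> k != j -> F k = 0) -> \sum_k F k = F i + F j.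
Proof.
move=> ij F0; rewrite (bigD1 i) //= (bigD1 j) 1?eq_sym //= big1 ?addr0 //.
by move=> k /andP[ki kj]; apply: F0.
Qed.

(** * Representations of the Nichols algebra and of its bosonization *)

Section NicholsRepresentation.
Variables (K : fieldType) (A : algType K) (a b : A) (gT : finGroupType).
Variables (n : nat) (g : 'I_n -> gT) (chi : 'I_n -> character K gT).
Variables i0 i1 : 'I_n.
Hypothesis i01 : i0 != i1.
Hypothesis qii : forall i, 1 + chi i (g i) != 0.
Let q := chi i1 (g i0).

Definition nichols_gen_mx (i : 'I_n) : 'M[A]_12 :=
  if i == i0 then mx_x A q else if i == i1 then mx_y a b else 0.
Local Notation P := nichols_gen_mx.

Lemma nichols_gen_mx0 : P i0 = mx_x A q.
Proof. by rewrite /P eqxx. Qed.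

Lemma nichols_gen_mx1 : P i1 = mx_y a b.
Proof. by rewrite /P eq_sym (negPf i01) eqxx. Qed.

Lemma nichols_gen_mx_deg3 i j k : P i * (P j * P k) = 0.
Proof.
have PP l : P l = 0 \/ P l \in [:: mx_x A q; mx_y a b].
  rewrite /P; case: ifP => _; first by right; rewrite inE eqxx.
  by case: ifP => _; [right; rewrite !inE eqxx orbT | left].
have [->|Pi] := PP i; first by rewrite mul0r.
have [->|Pj] := PP j; first by rewrite mul0r mulr0.
have [->|Pk] := PP k; first by rewrite !mulr0.
exact: mx_deg3 Pi Pj Pk.
Qed.

(** Only degree 2 terms in the two chosen generators can act. The squares have coefficient 0 because
    1 + χ_i(g_i) is nonzero, and the mixed terms form a multiple of x y - q y x, which acts by 0. *)
Lemma free_rep_nichols_ideal f : nichols_ideal g chi f -> free_rep P f = 0.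
Proof.
move=> If; apply/matrixP => r s; transitivity (0 : A); last by rewrite mxE.
have f2 := nichols_ideal_ge2 If.
rewrite (free_rep_deg2 nichols_gen_mx_deg3) //.
have fE := fun i j => nichols_ideal_deg2 i j If.
have fii i : f@_(FMonom [:: i; i]) = 0.
  have /eqP := fE i i; rewrite -{1}[f@__]mul1r -mulrDl mulf_eq0.
  by rewrite (negPf (qii i)) => /eqP.
have f10 : f@_(FMonom [:: i1; i0]) = - (q * f@_(FMonom [:: i0; i1])).
  by apply/eqP; rewrite -addr_eq0 fE.
have P0 i : i != i0 -> i != i1 -> P i = 0.
  by rewrite /P => /negPf -> /negPf ->.
rewrite (sum_support2 i01) => [|i i_0 i_1]; last first.
  by rewrite big1 // => j _; rewrite (P0 i) // mul0r mxE scaler0.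
have inner i : \sum_j f@_(FMonom [:: i; j]) *: (P i * P j) r s =
    f@_(FMonom [:: i; i0]) *: (P i * P i0) r s +
    f@_(FMonom [:: i; i1]) *: (P i * P i1) r s.
  apply: (sum_support2 i01) => j j0 j1.
  by rewrite (P0 j) // mulr0 mxE scaler0.
apply: etrans (congr2 +%R (inner i0) (inner i1)) _.
rewrite (fii i0) (fii i1); move: f10.
move: (f@_(FMonom [:: i0; i1])) (f@_(FMonom [:: i1; i0])) => c d ->.
rewrite !scale0r add0r addr0 nichols_gen_mx0 nichols_gen_mx1.
by rewrite mx_xy scalerA mulrC scaleNr addrN.
Qed.

Lemma nichols_rep_exists :
  exists rho : {rmorphism nichols g chi -> 'M[A]_12},
    forall f, rho (quot_pi (nichols_proper_ideal g chi) f) = free_rep P f.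
Proof.
have [h hE] := quot_lift (I := nichols_proper_ideal g chi) (f := free_rep P)
  free_rep_nichols_ideal.
by exists h.
Qed.

Lemma nichols_rep_scalar (rho : {rmorphism nichols g chi -> 'M[A]_12}) :
  (forall f, rho (quot_pi (nichols_proper_ideal g chi) f) = free_rep P f) ->
  forall c : K, rho c%:A = (c%:A)%:M.
Proof.
move=> rhoE c.
have E := quot_pi_scalar (nichols_proper_ideal g chi) c.
apply: etrans (congr1 rho (esym E)) _.
exact: etrans (rhoE _) (free_rep_scalar P c).
Qed.

Let D (z : gT) := torus_mx A (chi i0 z) (chi i1 z).

(** The covariance needed for [smash_lift]: [z] acts as the torus element with parameters the values
    of the two chosen characters. It is checked on generators and propagated by induction. *)
Lemma free_rep_tens_act z f :
  free_rep P (tens_act chi z f) * D z = D z * free_rep P f.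
Proof.
have DP i : D z * P i = ((chi i z)%:A)%:M * (P i * D z).
  rewrite /P; case: eqP => [->|_]; first exact: torus_mx_x.
  case: eqP => [->|_]; first exact: torus_mx_y.
  by rewrite mulr0 mul0r mulr0.
have actM u v : tens_act chi z (u * v) = tens_act chi z u * tens_act chi z v.
  by have [_ ->] := tens_act_monoid_morphism chi z.
elim/free_alg_ind: f => [f h IHf IHh|c|i f IHf].
- rewrite tens_actD; apply: etrans (congr1 ( *%R^~ (D z)) (free_repD P _ _)) _.
  rewrite mulrDl free_repD mulrDr; exact: (congr2 +%R IHf IHh).
- rewrite -free_algU_nil tens_actU /word_char big_nil mulr1 free_algU_nil.
  by rewrite free_rep_scalar alg_scalar_mxC.
apply: etrans (congr1 (fun h => free_rep P h * D z) (actM _ _)) _.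
rewrite tens_actU mul1r word_charU.
apply: etrans (congr1 ( *%R^~ (D z)) (free_rep_genZM P _ _ _)) _.
apply: etrans _ (congr1 ( *%R (D z)) (esym (free_rep_genM P _ _))).
by rewrite -!mulrA IHf !mulrA DP !mulrA.
Qed.

Lemma nichols_bosonization_rep_exists
    (rho : {rmorphism nichols g chi -> 'M[A]_12}) :
  (forall f, rho (quot_pi (nichols_proper_ideal g chi) f) = free_rep P f) ->
  exists h : {rmorphism nichols_bosonization g chi -> 'M[A]_12},
    forall c, h (smash_elt (nichols_alg_action g chi) c 1%g) = rho c.
Proof.
move=> rhoE; apply: (@smash_lift _ _ _ _ _ rho D).
- by rewrite /D !char1 torus_mx1.
- by move=> z t; rewrite /D !charM torus_mxM.
move=> z c; rewrite -[c]quot_reprK.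
apply: etrans (congr1 (fun h => rho h * D z) (nichols_act_pi _ _ _ _)) _.
by rewrite !rhoE free_rep_tens_act.
Qed.

End NicholsRepresentation.

(** * Wildness of both algebras *)

Lemma nichols_wild (K : fieldType) (gT : finGroupType) (n : nat)
    (g : 'I_n -> gT) (chi : 'I_n -> character K gT) (i0 i1 : 'I_n) :
  i0 != i1 -> (forall i, 1 + chi i (g i) != 0) ->
  wild (nichols g chi) /\ wild (nichols_bosonization g chi).
Proof.
move=> i01 qii.
pose a : free_alg K 2 := << fmu 0 >>; pose b : free_alg K 2 := << fmu 1 >>.
have [rho rhoE] := nichols_rep_exists a b i01 qii.
have rhoK := nichols_rep_scalar rhoE.
have [h hE] := nichols_bosonization_rep_exists rhoE.
pose gen i := quot_pi (nichols_proper_ideal g chi) << fmu i >>.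
have rho0 : rho (gen i0) = mx_x (free_alg K 2) (chi i1 (g i0)).
  by rewrite rhoE free_rep_gen nichols_gen_mx0.
have rho1 : rho (gen i1) = mx_y a b.
  by rewrite rhoE free_rep_gen nichols_gen_mx1.
split; first exact: wild_of_mx_x_mx_y rhoK rho0 rho1.
(* The embedding of the Nichols algebra into its bosonization; the two generators act there by the
   same matrices, so the same criterion applies. *)
pose elt c := smash_elt (nichols_alg_action g chi) c 1%g.
apply: (@wild_of_mx_x_mx_y _ _ _ (elt (gen i0)) (elt (gen i1)) h).
- move=> c; apply: etrans (congr1 h (smash_scalar _ c)) _.
  exact: etrans (hE _) (rhoK c).
- exact: etrans (hE _) rho0.
- exact: etrans (hE _) rho1.
Qed.

Theorem theorem6p5 (R : realType) (theta : nat) (a : 'M[int]_theta)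
    (gT : finGroupType) (g : 'I_theta -> gT)
    (chi : 'I_theta -> character R[i] gT) (N : 'I_theta -> nat) :
  (2 <= theta)%N ->
  cartan_finite_type a ->
  abelian [set: gT] ->
  (forall i, chi i (g i) != 1) ->
  (forall i j, chi j (g i) * chi i (g j) = chi i (g i) ^ a i j) ->
  (forall i, (N i).-primitive_root (chi i (g i))) ->
  (forall i, odd (N i)) ->
  (forall i, component_of_type a i DynG2 -> coprime (N i) 3) ->
  (forall i x, chi i x ^+ N i = 1) ->
  (forall c : 'I_theta -> bool,
      (forall x, \prod_i chi i x ^+ c i = 1) -> forall i, c i = false) ->
  wild (nichols g chi) /\ wild (nichols_bosonization g chi).
Proof.
move=> theta2 _ _ _ _ prim oddN _ _ _.
have theta0 := ltnW theta2.
apply: (@nichols_wild _ _ _ g chi (Ordinal theta0) (Ordinal theta2)) => // i.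
(* If χ_i(g_i) were -1, its power with odd exponent N_i would be both -1 and 1, which is impossible
   in characteristic 0. *)
apply/eqP => qN; have := prim_expr_order (prim i).
have -> : chi i (g i) = -1 by apply/eqP; rewrite -addr_eq0 addrC qN.
rewrite -signr_odd oddN expr1 => /eqP; rewrite eq_sym -addr_eq0.
by rewrite -(natrD _ 1 1) Num.Theory.pnatr_eq0.
Qed.
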